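(* Let $(M,g)$ be a tangential hypersurface, with unit normal vector field $N$, of a locally product-like statistical manifold $(\widetilde{M},\widetilde{g},\widetilde{\nabla},F)$. Then for all $X,Y,Z\in\Gamma(TM)$: $$\widetilde{R}(X,Y)Z=R(X,Y)Z-g(A^{\ast}_{N}Y,Z)A_{N}X+g(A^{\ast}_{N}X,Z)A_{N}Y+\{g((\overline{\nabla}^{\ast}_{X}A^{\ast})_{N}Y,Z)-g((\overline{\nabla}^{\ast}_{Y}A^{\ast})_{N}X,Z)\}N,$$ $$\widetilde{R}(X,Y)N=-(\overline{\nabla}_{X}A)_{N}Y+(\overline{\nabla}_{Y}A)_{N}X-\{g([A_{N},A^{\ast}_{N}]X,Y)-(d\kappa)(X,Y)\}N,$$ $$\widetilde{R}^{\ast}(X,Y)Z=R^{\ast}(X,Y)Z-g(A_{N}Y,Z)A^{\ast}_{N}X+g(A_{N}X,Z)A^{\ast}_{N}Y+\{g((\overline{\nabla}_{X}A)_{N}Y,Z)-g((\overline{\nabla}_{Y}A)_{N}X,Z)\}N,$$ $$\widetilde{R}^{\ast}(X,Y)N=-(\overline{\nabla}^{\ast}_{X}A^{\ast})_{N}Y+(\overline{\nabla}^{\ast}_{Y}A^{\ast})_{N}X+\{g([A_{N},A^{\ast}_{N}]X,Y)-(d\kappa)(X,Y)\}N.$$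
   Context: A statistical manifold $(\widetilde{M},\widetilde{g},\widetilde{\nabla})$ is a Riemannian manifold with a torsion-free affine connection $\widetilde{\nabla}$ such that $\widetilde{\nabla}\widetilde{g}$ is totally symmetric. The dual connection $\widetilde{\nabla}^{\ast}$ is defined by $Z\widetilde{g}(X,Y)=\widetilde{g}(X,\widetilde{\nabla}^{\ast}_{Z}Y)+\widetilde{g}(\widetilde{\nabla}_{Z}X,Y)$; it is also torsion-free. A locally product-like statistical manifold $(\widetilde{M},\widetilde{g},\widetilde{\nabla},F)$ is a statistical manifold with a $(1,1)$-tensor field $F$ satisfying $F^{2}=I$ and $\widetilde{\nabla}F=0$, together with the $(1,1)$-tensor field $F^{\ast}$ satisfying $\widetilde{g}(FX,Y)=\widetilde{g}(X,F^{\ast}Y)$. A hypersurface $(M,g)$ (induced metric $g$, unit normal $N$) is tangential if $FN$ and $F^{\ast}N$ are tangent to $M$. The Gauss and Weingarten formulas, for $X,Y\in\Gamma(TM)$, are $$\widetilde{\nabla}_{X}Y=\nabla_{X}Y+g(A^{\ast}_{N}X,Y)N,\quad \widetilde{\nabla}_{X}N=-A_{N}X+\kappa(X)N,$$ $$\widetilde{\nabla}^{\ast}_{X}Y=\nabla^{\ast}_{X}Y+g(A_{N}X,Y)N,\quad \widetilde{\nabla}^{\ast}_{X}N=-A^{\ast}_{N}X-\kappa(X)N,$$ which define the induced connections $\nabla,\nabla^{\ast}$ on $M$, the shape operators $A_{N},A^{\ast}_{N}$ and the $1$-form $\kappa$ on $M$. $\widetilde{R},\widetilde{R}^{\ast},R,R^{\ast}$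 are the curvature tensors of $\widetilde{\nabla},\widetilde{\nabla}^{\ast},\nabla,\nabla^{\ast}$ respectively, with the convention $R(X,Y)Z=\nabla_{X}\nabla_{Y}Z-\nabla_{Y}\nabla_{X}Z-\nabla_{[X,Y]}Z$. Moreover $$(\overline{\nabla}_{X}A)_{N}Y=\nabla_{X}(A_{N}Y)-\kappa(X)A_{N}Y-A_{N}(\nabla_{X}Y),$$ $$(\overline{\nabla}^{\ast}_{X}A^{\ast})_{N}Y=\nabla^{\ast}_{X}(A^{\ast}_{N}Y)+\kappa(X)A^{\ast}_{N}Y-A^{\ast}_{N}(\nabla^{\ast}_{X}Y),$$ $(d\kappa)(X,Y)=(\nabla_{X}\kappa)(Y)-(\nabla_{Y}\kappa)(X)$ with $(\nabla_{X}\kappa)(Y)=X\{\kappa(Y)\}-\kappa(\nabla_{X}Y)$, and $[A_{N},A^{\ast}_{N}]=A_{N}A^{\ast}_{N}-A^{\ast}_{N}A_{N}$. *)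

(* Defs.v *)
From HB Require Import structures.
From mathcomp Require Import all_boot all_order all_algebra.
From mathcomp Require Import all_classical all_reals all_analysis.

Set Implicit Arguments.
Unset Strict Implicit.
Unset Printing Implicit Defensive.

Import Order.TTheory GRing.Theory Num.Theory.
Import numFieldNormedType.Exports.

Local Open Scope classical_set_scope.
Local Open Scope ring_scope.

(* Conventions.  A smooth manifold carries a family of charts indexed by its
   points, the chart [chart p] being defined around [p]; an arbitrary atlas
   gives such a family by choosing for every point a chart around it.  A
   tangent vector at [p] is represented by its components in the coordinate
   frame of [chart p] at [p], so every tangent space is ['rV[R]_n], and the
   components with respect to other charts are obtained with [coord_change].
   Maps such as vector fields are total functions, and smoothness, which is
   always meant as C^oo, is a local predicate "smooth in a neighbourhood of p". *)

Section SmoothFunctions.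
Context {R : realType}.

Fixpoint Ck (V W : normedModType R) (k : nat) (U : set V) (f : V -> W) : Prop :=
  match k with
  | 0 => forall x, U x -> {for x, continuous f}
  | k'.+1 => (forall x, U x -> differentiable f x) /\
             (forall v, Ck k' U (fun x => 'D_v f x))
  end.

(* meaningful for open [U] *)
Definition smooth_on (V W : normedModType R) (U : set V) (f : V -> W) : Prop :=
  forall k, Ck k U f.

Definition smooth_near (V W : normedModType R) (f : V -> W) (x : V) : Prop :=
  exists U : set V, [/\ open U, U x & smooth_on U f].

End SmoothFunctions.

Record manifold (R : realType) (n : nat) := Manifold {
  carrier :> topologicalType;
  chart_dom : carrier -> set carrier;
  chart : carrier -> carrier -> 'rV[R]_n;
  param : carrier -> 'rV[R]_n -> carrier;
  manifold_hausdorff : hausdorff_space carrier;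
  manifold_second_countable : @second_countable carrier;
  chart_dom_center : forall p, chart_dom p p;
  chart_dom_open : forall p, open (chart_dom p);
  chart_img_open : forall p, open (chart p @` chart_dom p);
  chartK : forall p q, chart_dom p q -> param p (chart p q) = q;
  chart_continuous : forall p q, chart_dom p q -> {for q, continuous (chart p)};
  param_continuous : forall p x, (chart p @` chart_dom p) x ->
    {for x, continuous (param p)};
  chart_smooth : forall p q,
    smooth_on (chart p @` (chart_dom p `&` chart_dom q)) (chart q \o param p)
}.

Section Calculus.
Context {R : realType} {n : nat} {M : manifold R n}.

Definition smooth_at (W : normedModType R) (f : M -> W) (p : M) : Prop :=
  smooth_near (f \o param p) (chart p p).

(* The derivative u f of a function f in the direction of u in T_pM. *)
Definition dir_der (f : M -> R) (p : M) (u : 'rV[R]_n) : R :=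
  'd (f \o param p : 'rV[R]_n -> R^o) (chart p p) u.

(* From the components [u], in the chart [c], of a tangent vector at [q] to its
   components in the chart [d]. *)
Definition coord_change (c d q : M) (u : 'rV[R]_n) : 'rV[R]_n :=
  'd (chart d \o param c) (chart c q) u.

(* The local vector field having constant components [u] in the chart [c]. *)
Definition coord_field (c : M) (u : 'rV[R]_n) : M -> 'rV[R]_n :=
  fun q => coord_change c q q u.

End Calculus.

Section Maps.
Context {R : realType} {n m : nat} {M : manifold R n} {M' : manifold R m}.

Definition smooth_map (h : M -> M') : Prop :=
  continuous h /\ forall p, smooth_at (fun q => chart (h p) (h q)) p.

(* The differential T_pM -> T_(h p)M' *)
Definition dmap (h : M -> M') (p : M) (u : 'rV[R]_n) : 'rV[R]_m :=
  'd (chart (h p) \o h \o param p) (chart p p) u.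

Definition immersion (h : M -> M') : Prop :=
  smooth_map h /\ forall p, injective (dmap h p).

(* A vector field along [h] is a map [V] with [V q] in T_(h q)M'.  Here it is
   expressed near [p] in the charts [chart p] of M and [chart (h p)] of M'. *)
Definition local_rep (h : M -> M') (V : M -> 'rV[R]_m) (p : M) :
    'rV[R]_n -> 'rV[R]_m :=
  fun x => let q := param p x in coord_change (h q) (h p) (h q) (V q).

Definition smooth_along_at (h : M -> M') (V : M -> 'rV[R]_m) (p : M) : Prop :=
  smooth_near (local_rep h V p) (chart p p).

Definition smooth_along (h : M -> M') (V : M -> 'rV[R]_m) : Prop :=
  forall p, smooth_along_at h V p.

Definition pushforward (h : M -> M') (X : M -> 'rV[R]_n) : M -> 'rV[R]_m :=
  fun q => dmap h q (X q).

End Maps.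

Section Fields.
Context {R : realType} {n : nat} {M : manifold R n}.
Implicit Types X Y Z : M -> 'rV[R]_n.

Definition smooth_field_at X (p : M) : Prop :=
  smooth_along_at (fun q : M => q) X p.

(* X is an element of Gamma(TM) *)
Definition smooth_field X : Prop := forall p, smooth_field_at X p.

Definition lie_bracket X Y : M -> 'rV[R]_n := fun p =>
  'd (local_rep (fun q : M => q) Y p) (chart p p) (X p) -
  'd (local_rep (fun q : M => q) X p) (chart p p) (Y p).

End Fields.

Record metric (R : realType) (n : nat) (M : manifold R n) := Metric {
  metric_fun :> M -> 'rV[R]_n -> 'rV[R]_n -> R;
  metric_sym : forall p u v, metric_fun p u v = metric_fun p v u;
  metric_linear : forall p a u v w,
    metric_fun p (a *: u + v) w = a * metric_fun p u w + metric_fun p v w;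
  metric_pos : forall p u, u != 0 -> 0 < metric_fun p u u;
  metric_smooth : forall p (X Y : M -> 'rV[R]_n),
    smooth_field_at X p -> smooth_field_at Y p ->
    smooth_at (fun q => metric_fun q (X q) (Y q) : R^o) p
}.

(* [nabla p u Y] is the covariant derivative at [p] of the local vector field
   [Y] in the direction of the tangent vector [u] at [p]; it is meaningless
   when [Y] is not smooth in a neighbourhood of [p]. *)
Record connection (R : realType) (n : nat) (M : manifold R n) := Connection {
  connection_fun :> M -> 'rV[R]_n -> (M -> 'rV[R]_n) -> 'rV[R]_n;
  connection_linear : forall p Y, smooth_field_at Y p -> forall a u v,
    connection_fun p (a *: u + v) Y =
    a *: connection_fun p u Y + connection_fun p v Y;
  connection_add : forall p Y Z, smooth_field_at Y p -> smooth_field_at Z p ->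
    forall u, connection_fun p u (fun q => Y q + Z q) =
              connection_fun p u Y + connection_fun p u Z;
  connection_leibniz : forall p (f : M -> R) Y,
    smooth_at (f : M -> R^o) p -> smooth_field_at Y p ->
    forall u, connection_fun p u (fun q => f q *: Y q) =
              dir_der f p u *: Y p + f p *: connection_fun p u Y;
  connection_smooth : forall p X Y, smooth_field_at X p -> smooth_field_at Y p ->
    smooth_field_at (fun q => connection_fun q (X q) Y) p
}.

Record tensor11 (R : realType) (n : nat) (M : manifold R n) := Tensor11 {
  tensor11_fun :> M -> {linear 'rV[R]_n -> 'rV[R]_n};
  tensor11_smooth : forall p (X : M -> 'rV[R]_n), smooth_field_at X p ->
    smooth_field_at (fun q => tensor11_fun q (X q)) p
}.

Record one_form (R : realType) (n : nat) (M : manifold R n) := OneForm {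
  one_form_fun :> M -> {linear 'rV[R]_n -> R^o};
  one_form_smooth : forall p (X : M -> 'rV[R]_n), smooth_field_at X p ->
    smooth_at (fun q => one_form_fun q (X q)) p
}.

Section Connections.
Context {R : realType} {n : nat} {M : manifold R n}.
Implicit Types (X Y Z : M -> 'rV[R]_n) (D : connection M).

Definition curvature D X Y Z : M -> 'rV[R]_n := fun p =>
  D p (X p) (fun q => D q (Y q) Z) - D p (Y p) (fun q => D q (X q) Z) -
  D p (lie_bracket X Y p) Z.

(* The curvature tensor on tangent vectors at [p]: as the curvature is tensorial,
   these may be extended to local vector fields in any way, here by coordinate
   fields. *)
Definition curvature_tensor D (p : M) (u v w : 'rV[R]_n) : 'rV[R]_n :=
  curvature D (coord_field p u) (coord_field p v) (coord_field p w) p.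

Definition torsion_free D : Prop :=
  forall p X Y, smooth_field_at X p -> smooth_field_at Y p ->
  D p (X p) Y - D p (Y p) X = lie_bracket X Y p.

(* (nabla_X g)(Y, Z) *)
Definition nabla_metric (g : metric M) D X Y Z : M -> R := fun p =>
  dir_der (fun q => g q (Y q) (Z q)) p (X p) -
  g p (D p (X p) Y) (Z p) - g p (Y p) (D p (X p) Z).

Definition statistical (g : metric M) D : Prop :=
  torsion_free D /\
  forall p X Y Z, smooth_field_at X p -> smooth_field_at Y p ->
    smooth_field_at Z p ->
    nabla_metric g D X Y Z p = nabla_metric g D Y X Z p /\
    nabla_metric g D X Y Z p = nabla_metric g D X Z Y p.

Definition dual_connection (g : metric M) D (Ds : connection M) : Prop :=
  forall p X Y Z, smooth_field_at X p -> smooth_field_at Y p ->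
    smooth_field_at Z p ->
    dir_der (fun q => g q (X q) (Y q)) p (Z p) =
    g p (X p) (Ds p (Z p) Y) + g p (D p (Z p) X) (Y p).

Definition product_like (g : metric M) D (F Fs : tensor11 M) : Prop :=
  [/\ forall p u, F p (F p u) = u,
      forall p X Y, smooth_field_at X p -> smooth_field_at Y p ->
        D p (X p) (fun q => F q (Y q)) - F p (D p (X p) Y) = 0
    & forall p u v, g p (F p u) v = g p u (Fs p v)].

(* (nabla-bar_X A)_N Y and (nabla-bar^*_X A^* )_N Y *)
Definition nabla_bar D (A : tensor11 M) (kappa : one_form M) X Y :
    M -> 'rV[R]_n := fun p =>
  D p (X p) (fun q => A q (Y q)) - kappa p (X p) *: A p (Y p) -
  A p (D p (X p) Y).

Definition nabla_bar_star (Ds : connection M) (As : tensor11 M)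
    (kappa : one_form M) X Y : M -> 'rV[R]_n := fun p =>
  Ds p (X p) (fun q => As q (Y q)) + kappa p (X p) *: As p (Y p) -
  As p (Ds p (X p) Y).

Definition nabla_form D (kappa : one_form M) X Y : M -> R := fun p =>
  dir_der (fun q => kappa q (Y q)) p (X p) - kappa p (D p (X p) Y).

Definition d_form D (kappa : one_form M) X Y : M -> R := fun p =>
  nabla_form D kappa X Y p - nabla_form D kappa Y X p.

Definition tensor_commutator (A B : tensor11 M) (p : M) (u : 'rV[R]_n) :
    'rV[R]_n := A p (B p u) - B p (A p u).

End Connections.

Section Hypersurfaces.
Context {R : realType} {n : nat} {M : manifold R n} {M' : manifold R n.+1}.
Variable h : M -> M'.

Definition induced_metric (g : metric M') (p : M) (u v : 'rV[R]_n) : R :=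
  g (h p) (dmap h p u) (dmap h p v).

(* The derivative at [p], in the direction of [u] in T_pM, of a vector field [V]
   along [h].  If V = V^k d_k near p, where the d_k are the coordinate fields of
   M' around h(p), this is (u V^k) d_k + V^k(p) nabla_(dh u) d_k. *)
Definition derivative_along (D : connection M') (p : M) (u : 'rV[R]_n)
    (V : M -> 'rV[R]_n.+1) : 'rV[R]_n.+1 :=
  'd (local_rep h V p) (chart p p) u +
  D (h p) (dmap h p u) (coord_field (h p) (V p)).

Definition unit_normal (g : metric M') (N : M -> 'rV[R]_n.+1) : Prop :=
  [/\ smooth_along h N,
      forall p, g (h p) (N p) (N p) = 1
    & forall p u, g (h p) (N p) (dmap h p u) = 0].

Definition tangential (F Fs : tensor11 M') (N : M -> 'rV[R]_n.+1) : Prop :=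
  forall p, (exists u, F (h p) (N p) = dmap h p u) /\
            (exists u, Fs (h p) (N p) = dmap h p u).

Definition gauss_formula (g : metric M') (N : M -> 'rV[R]_n.+1)
    (D' : connection M') (D : connection M) (B : tensor11 M) : Prop :=
  forall p (X Y : M -> 'rV[R]_n), smooth_field_at X p -> smooth_field_at Y p ->
  derivative_along D' p (X p) (pushforward h Y) =
  dmap h p (D p (X p) Y) + induced_metric g p (B p (X p)) (Y p) *: N p.

Definition weingarten_formula (N : M -> 'rV[R]_n.+1) (D' : connection M')
    (A : tensor11 M) (kappa : M -> 'rV[R]_n -> R) : Prop :=
  forall p u, derivative_along D' p u N =
    - dmap h p (A p u) + kappa p u *: N p.

(* [D], [Ds] are the connections induced by [D'] and its dual [Ds'], [A], [As]
   the shape operators A_N, A_N^* and [kappa] the normal 1-form. *)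
Definition gauss_weingarten (g : metric M') (N : M -> 'rV[R]_n.+1)
    (D' Ds' : connection M') (D Ds : connection M) (A As : tensor11 M)
    (kappa : one_form M) : Prop :=
  [/\ gauss_formula g N D' D As,
      weingarten_formula N D' A (fun p u => kappa p u),
      gauss_formula g N Ds' Ds A
    & weingarten_formula N Ds' As (fun p u => - kappa p u)].

End Hypersurfaces.

(* Main.v *)
(* Differentiating along [iota] is a connection on the pullback of the ambient
   tangent bundle: it is local, satisfies the Leibniz rule, and on restrictions
   of ambient fields it is the ambient connection.  Since every field along
   [iota] is, near a point, a combination of restricted coordinate fields, these
   properties show that the ambient curvature R'(dX, dY) V is the commutator
   P_X P_Y V - P_Y P_X V - P_[X,Y] V of derivatives along [iota], and that
   torsion-freeness and metric duality pull back as well.  Taking V = dZ and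
   V = N, the Gauss and Weingarten formulas turn this commutator into the first
   two equations; they use the symmetry of the shape operators and the duality
   of the induced connections, both read off from tangential and normal parts.
   The hypotheses are invariant under exchanging the ambient connection with
   its dual, A with A^*, and kappa with -kappa, which gives the other two. *)

Require Import Defs.
From HB Require Import structures.
From mathcomp Require Import all_boot all_order all_algebra.
From mathcomp Require Import all_classical all_reals all_analysis.
From mathcomp Require Import ring lra.

Import Order.TTheory GRing.Theory Num.Theory.
Import numFieldNormedType.Exports.

Set Implicit Arguments.
Unset Strict Implicit.
Unset Printing Implicit Defensive.

Local Open Scope classical_set_scope.
Local Open Scope ring_scope.

(** The charts are the obstacle that shapes the proof. Every point carries its own chart, and
    tangent vectors are stored in it, so a field such as [fun q => derivative_along h D q (Y q) V]
    is computed in charts that change with [q]. It can be differentiated again only after it has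
    been rewritten, on a whole neighbourhood of [p], in the chart at [p]; hence the many identities
    stated with [\near p] and proved together with smoothness. The analytic input is the symmetry of
    second derivatives. It makes the Lie bracket, defined by differentials of components, act as a
    commutator of derivations; applied to coordinate functions composed with the immersion, this
    computes the differential of a bracket. That computation serves twice: for torsion, and for the
    curvature of restricted coordinate fields, where it cancels the [lie_bracket] term. Exchanging
    the connections also requires the dual ambient connection to be torsion-free, which is extracted
    from the total symmetry of the covariant derivative of the metric. *)

(** * Smooth functions on normed spaces *)

Section Differentials.
Context {R : realType}.
Implicit Types V W : normedModType R.

(** The little-o expansion of [f] at [x] only sees values near [x], so it is also one for [g];
    uniqueness of the differential concludes. *)
Lemma near_eq_diff V W (f g : V -> W) (x : V) :
  (\forall y \near x, f y = g y) -> differentiable f x ->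
  differentiable g x /\ 'd g x = 'd f x :> (V -> W).
Proof.
move=> fg df.
have [dc dE] := (diff_locallyP _ _).1 df.
have E : g \o shift x = cst (g x) + 'd f x +o_ 0 id.
  apply/eqaddoP => e e0; move/eqaddoP : dE => /(_ e e0).
  rewrite -(nbhs_singleton fg) => H; near=> y.
  have -> : ((g \o shift x) - (cst (f x) + 'd f x)) y =
            ((f \o shift x) - (cst (f x) + 'd f x)) y.
    rewrite !fctE /= ; congr (_ - _); apply/esym.
    by near: y; move: fg; rewrite (near_shift 0 x) /= subr0.
  by near: y.
have dg : 'd g x = 'd f x :> (V -> W) by apply: diff_unique.
split; last exact: dg.
by apply/diff_locallyP; rewrite dg; split; [exact: dc|exact: E].
Unshelve. all: by end_near. Qed.

Lemma scaler_is_bilinear W :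
  bilinear_for
    (GRing.Scale.Law.clone _ _ ( *:%R : R -> W -> W) _)
    (GRing.Scale.Law.clone _ _ ( *:%R : R -> W -> W) _)
    (fun (k : R^o) (w : W) => k *: w).
Proof.
split=> [u'|u] a x y /=; first by rewrite scalerDl scalerA.
by rewrite scalerDr !scalerA mulrC.
Qed.

(** Scaling is a continuous bilinear map, so this is the chain rule through the pair formed by [k]
    and [f]. *)
Lemma is_diff_scale V W (k : V -> R^o) (f : V -> W) x :
  differentiable k x -> differentiable f x ->
  differentiable (fun y => k y *: f y) x /\
  forall v, 'd (fun y => k y *: f y) x v = 'd k x v *: f x + k x *: 'd f x v.
Proof.
move=> dk df.
pose bM := bilinear_isBilinear.Build R R^o W W _ _ _ (scaler_is_bilinear W).
pose b : {bilinear R^o -> W -> W} := HB.pack (fun (k : R^o) (w : W) => k *: w) bM.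
have bc : continuous (fun p : R^o * W => b p.1 p.2) by exact: scale_continuous.
have dp := differentiable_pair dk df.
have dbl := differentiable_bilin (k x, f x) bc.
split; first exact: (differentiable_comp dp dbl).
move=> v; have := diff_comp dp dbl; rewrite (diff_bilin _ bc) (diff_pair dk df).
by move/(congr1 (fun h => h v)) => /= ->; rewrite addrC.
Qed.

End Differentials.

Section SmoothCalculus.
Context {R : realType}.
Implicit Types V W : normedModType R.

Lemma diff_entry V m n (f : V -> 'M[R]_(m, n)) x i j : differentiable f x ->
  differentiable (fun y => f y i j : R^o) x /\
  forall v, 'd (fun y => f y i j : R^o) x v = 'd f x v i j.
Proof.
move=> df.
have dc : differentiable (fun y => f y i j : R^o) x.
  exact: (@differentiable_comp R V 'M[R]_(m, n) R f (fun N => N i j) x df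
            (differentiable_coord _ _ _)).
split=> // v; rewrite -!deriveE// derive_mx ?mxE//; exact: diff_derivable.
Qed.

Lemma diff_basis n W (g : 'rV[R]_n -> W) x v :
  'd g x v = \sum_(i < n) v 0 i *: 'd g x (delta_mx 0 i).
Proof. by rewrite {1}[v]row_sum_delta linear_sum; under eq_bigr do rewrite linearZ. Qed.

Lemma Ck_sub V W k (U U' : set V) (f : V -> W) :
  U' `<=` U -> Ck k U f -> Ck k U' f.
Proof.
elim: k f => [|k IH] f UU' /=; first by move=> cf x /UU'; apply: cf.
by move=> [df Df]; split=> [x /UU'|v]; [apply: df|apply: IH].
Qed.

Lemma Ck_diff V W k (U : set V) (f : V -> W) x :
  Ck k.+1 U f -> U x -> differentiable f x.
Proof. by move=> [df _]; apply: df. Qed.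

Lemma CkW V W k (U : set V) (f : V -> W) : Ck k.+1 U f -> Ck k U f.
Proof.
elim: k f => [|k IH] f [df Df] /=.
  by move=> x Ux; apply: differentiable_continuous; apply: df.
by split=> // v; apply: IH; apply: Df.
Qed.

Lemma Ck_eq V W k (U : set V) (f g : V -> W) : open U ->
  (forall x, U x -> f x = g x) -> Ck k U f -> Ck k U g.
Proof.
move=> Uo; elim: k f g => [|k IH] f g fg /=.
  move=> cf x Ux; have nfg : {near x, f =1 g}.
    by apply: filterS (open_nbhs_nbhs (conj Uo Ux)) => y /fg.
  have gx : f @ x --> g x by rewrite -(fg x Ux); exact: cf.
  exact: cvg_trans (near_eq_cvg nfg) gx.
have nfg x : U x -> \forall y \near x, f y = g y.
  by move=> Ux; apply: filterS (open_nbhs_nbhs (conj Uo Ux)) => y /fg.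
move=> [df Df]; split=> [x Ux|v].
  by have [] := near_eq_diff (nfg x Ux) (df x Ux).
by apply: IH (Df v) => x Ux; apply: near_eq_derive; apply: nfg.
Qed.

Lemma Ck_cst V W k (U : set V) (a : W) : Ck k U (cst a).
Proof.
elim: k a => [|k IH] a /=; first by move=> x _; apply: cst_continuous.
split=> [x _|v]; first exact: differentiable_cst.
by rewrite (_ : (fun x => _) = cst 0) //; apply/funext => x; apply: derive_cst.
Qed.

Lemma CkD V W k (U : set V) (f g : V -> W) : open U ->
  Ck k U f -> Ck k U g -> Ck k U (fun x => f x + g x).
Proof.
move=> Uo; elim: k f g => [|k IH] f g /=.
  by move=> cf cg x Ux; apply: continuousD; [apply: cf|apply: cg].
move=> [df Df] [dg Dg]; split=> [x Ux|v].
  by apply: differentiableD; [apply: df|apply: dg].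
apply: Ck_eq (IH _ _ (Df v) (Dg v)) => // x Ux.
by rewrite -deriveD//; apply: diff_derivable; [apply: df|apply: dg].
Qed.

Lemma Ck_scale V W k (U : set V) (a : V -> R^o) (f : V -> W) : open U ->
  Ck k U a -> Ck k U f -> Ck k U (fun x => a x *: f x).
Proof.
move=> Uo; elim: k a f => [|k IH] a f.
  by move=> ca cf x Ux /=; apply: continuousZ; [apply: ca|apply: cf].
move=> ha hf; have [da Da] := ha; have [df Df] := hf.
split=> [x Ux|v]; first by have [] := is_diff_scale (da x Ux) (df x Ux).
apply: Ck_eq (CkD Uo (IH _ _ (Da v) (CkW hf)) (IH _ _ (CkW ha) (Df v))) => //.
move=> x Ux; have [d1 d2] := is_diff_scale (da x Ux) (df x Ux).
by rewrite [RHS](deriveE v d1) d2 (deriveE v (da x Ux)) (deriveE v (df x Ux)).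
Qed.

Lemma Ck_sum V W k (U : set V) I (r : seq I) (f : I -> V -> W) : open U ->
  (forall i, Ck k U (f i)) -> Ck k U (fun x => \sum_(i <- r) f i x).
Proof.
move=> Uo hf; elim: r => [|i r IH].
  by apply: Ck_eq (Ck_cst _ _ 0) => // x _; rewrite big_nil.
by apply: Ck_eq (CkD Uo (hf i) IH) => // x _; rewrite big_cons.
Qed.

Lemma Ck_entry V k (U : set V) m n (f : V -> 'M[R]_(m, n)) i j : open U ->
  Ck k U f -> Ck k U (fun x => f x i j : R^o).
Proof.
move=> Uo; elim: k f => [|k IH] f /=.
  move=> cf x Ux; exact: (@continuous_comp _ _ _ f (fun N => N i j : R^o) x (cf x Ux)
    (@coord_continuous R m n i j (f x))).
move=> [df Df]; split=> [x Ux|v]; first by have [] := diff_entry i j (df x Ux).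
apply: Ck_eq (IH _ (Df v)) => // x Ux.
have [d1 d2] := diff_entry i j (df x Ux).
by rewrite (deriveE _ d1) (deriveE _ (df x Ux)) d2.
Qed.

(** The middle space consists of row vectors so that the chain rule becomes a finite sum of products
    of an entry of ['D_v f] with a partial derivative of [g] composed with [f]; the induction
    hypothesis covers the second factor. *)
Lemma Ck_comp V W k (U : set V) n (U' : set 'rV[R]_n) (f : V -> 'rV[R]_n)
    (g : 'rV[R]_n -> W) : open U ->
  (forall x, U x -> U' (f x)) ->
  Ck k U f -> Ck k U' g -> Ck k U (g \o f).
Proof.
move=> Uo fU; elim: k f g fU => [|k IH] f g fU.
  move=> cf cg x Ux; exact: (@continuous_comp _ _ _ f g x (cf x Ux) (cg _ (fU x Ux))).
move=> hf hg; have [df Df] := hf; have [dg Dg] := hg.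
split=> [x Ux|v].
  by apply: differentiable_comp; [apply: df|apply/dg/fU].
have h i : Ck k U (fun x => ('D_v f x) 0 i *: 'D_(delta_mx 0 i) g (f x)).
  apply: (@Ck_scale _ _ _ _ (fun x => ('D_v f x) 0 i)) => //.
    exact: Ck_entry (Df v).
  exact: IH fU (CkW hf) (Dg _).
apply: Ck_eq (Ck_sum (index_enum 'I_n) Uo h) => // x Ux.
have dfx := df x Ux; have dgx := dg _ (fU x Ux).
rewrite [RHS](deriveE v (differentiable_comp dfx dgx)) (diff_comp dfx dgx) /=.
rewrite [RHS]diff_basis.
by apply: eq_bigr => i _; rewrite (deriveE _ dfx) (deriveE _ dgx).
Qed.

Lemma Ck_derive V W k (U : set V) (f : V -> W) v :
  Ck k.+1 U f -> Ck k U (fun x => 'D_v f x).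
Proof. by move=> [_ Df]; apply: Df. Qed.

End SmoothCalculus.

(** * Symmetry of second derivatives *)

Section SecondDerivatives.
Context {R : realType} {V : normedModType R}.
Implicit Types (F : V -> R^o) (u v x : V).

Lemma derive_line F x u (t : R) : differentiable F (x + t *: u) ->
  is_derive t 1 (fun s : R => F (x + s *: u) : R) ('D_u F (x + t *: u)).
Proof.
move=> dF.
have dl : is_diff t (fun s : R^o => x + s *: u) (fun s : R^o => s *: u).
  have -> : (fun s : R^o => s *: u) = 0 + (fun s : R^o => s *: u).
    by apply/funext => s; rewrite !fctE add0r.
  exact: (is_diffD (is_diff_cst x t) (is_diff_scalel t u)).
have dc : differentiable (F \o (fun s : R^o => x + s *: u)) t.
  exact: differentiable_comp.
split; first exact: diff_derivable.
rewrite [LHS](deriveE _ dc) diff_comp//= (deriveE _ dF).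
by rewrite (@diff_val _ _ _ _ _ _ _ dl) scale1r.
Qed.

(* Two applications of the mean value theorem; the second-order difference on
   the left is symmetric in [u] and [v]. *)
Lemma mixed_difference F x u v (s : R) : 0 < s ->
  (forall a b : R, 0 <= a <= s -> 0 <= b <= s ->
    differentiable F (x + a *: u + b *: v) /\
    differentiable ('D_u F) (x + a *: u + b *: v)) ->
  exists a b : R, [/\ 0 <= a <= s, 0 <= b <= s &
    F (x + s *: u + s *: v) - F (x + s *: u) - (F (x + s *: v) - F x) =
    'D_v ('D_u F) (x + a *: u + b *: v) * s * s].
Proof.
move=> s0 dF; have ss : 0 <= s <= s by rewrite lexx ltW.
have itv_sub (t : R) : t \in `]0, s[ -> 0 <= t <= s.
  by rewrite in_itv /= => /andP[/ltW -> /ltW ->].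
have zs : 0 <= (0 : R) <= s by rewrite lexx ltW.
(* The increment of [F] in direction [v], moved along [u]. The mean value theorem for [f] yields
   [a]; applied to ['D_u F] in direction [v], it then yields [b]. *)
pose f (t : R) : R := F (x + s *: v + t *: u) - F (x + t *: u).
have df t : 0 <= t <= s ->
    is_derive t 1 f ('D_u F (x + t *: u + s *: v) - 'D_u F (x + t *: u)).
  move=> ts; apply: is_deriveB.
    rewrite addrAC; apply: derive_line; rewrite addrAC.
    by have [] := dF _ _ ts ss.
  apply: derive_line; have [] := dF _ _ ts zs.
  by rewrite scale0r addr0.
have [|a asr] := @MVT R f _ 0 s s0 (fun t h => df t (itv_sub t h)).
  move=> t; apply: derivable_within_continuous => y.
  by rewrite in_itv /= => /df [].
move: asr; rewrite in_itv /= => /andP[/ltW a0 /ltW as'].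
have as_ : 0 <= a <= s by rewrite a0 as'.
rewrite /f scale0r !addr0 subr0 (addrAC x (s *: v)) => E1.
pose g (t : R) : R := 'D_u F (x + a *: u + t *: v).
have dg t : 0 <= t <= s -> is_derive t 1 g ('D_v ('D_u F) (x + a *: u + t *: v)).
  by move=> ts; apply: derive_line; have [] := dF _ _ as_ ts.
have [|b bsr] := @MVT R g _ 0 s s0 (fun t h => dg t (itv_sub t h)).
  move=> t; apply: derivable_within_continuous => y.
  by rewrite in_itv /= => /dg [].
move: bsr; rewrite in_itv /= => /andP[/ltW b0 /ltW bs'].
rewrite /g scale0r !addr0 subr0 => E2.
exists a, b; split; rewrite ?a0 ?b0//.
by rewrite -E2 -E1; ring.
Qed.

Lemma dist_lt_half (e p q r : R) :
  `|p - r| < e / 2 -> `|q - r| < e / 2 -> `|p - q| <= e.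
Proof.
move=> h1 h2; rewrite (splitr e) -(subrKA r).
by apply: le_trans (ler_normD _ _) _; apply: lerD; rewrite ltW// distrC.
Qed.

(** The same second difference equals [s * s] times either mixed derivative, each at some point of a
    small parallelogram at [x]; continuity brings both within [e / 2] of their values at [x]. *)
Lemma derive_comm F x u v : smooth_near F x ->
  'D_v ('D_u F) x = 'D_u ('D_v F) x.
Proof.
(* Order three makes the second derivatives differentiable, hence continuous. *)
move=> [U [Uo Ux sF]]; have [dF DF] := sF 3.
have cont w w' : {for x, continuous ('D_w' ('D_w F))}.
  have [_ D2] := DF w; have [d _] := D2 w'.
  by apply: differentiable_continuous; apply: d.
apply/eqP; rewrite -subr_eq0 -normr_le0; apply/ler_addgt0Pl => e e0; rewrite addr0.
have e2 : 0 < e / 2 by rewrite divr_gt0.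
have near_cont w w' : \forall y \near x, `|'D_w' ('D_w F) x - 'D_w' ('D_w F) y| < e / 2.
  have := cont w w'; exact: (fun h => (cvgrPdist_lt _ _).1 h _ e2).
have H : \forall y \near x, [/\ U y, `|'D_v ('D_u F) x - 'D_v ('D_u F) y| < e / 2
    & `|'D_u ('D_v F) x - 'D_u ('D_v F) y| < e / 2].
  apply: (filterS3 _ _ (open_nbhs_nbhs (conj Uo Ux)) (near_cont u v) (near_cont v u)).
  by move=> y h1 h2 h3; split; [exact: h1|exact: h2|exact: h3].
have [r /= r0 rP] := (nbhs_ballP _ _).1 H.
(* Points of the parallelogram are at distance at most [s * (1 + |u| + |v|) = r / 2] from [x]; the
   summand 1 keeps the denominator positive when [u] and [v] vanish. *)
pose s := r / (2 * (1 + `|u| + `|v|)).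
have m0 : 0 < 1 + `|u| + `|v| by rewrite !ltr_wpDr// ltr01.
have s0 : 0 < s by rewrite divr_gt0// mulr_gt0.
have inB (a b : R) : 0 <= a <= s -> 0 <= b <= s ->
    ball x r (x + a *: u + b *: v).
  move=> /andP[a0 as_] /andP[b0 bs].
  rewrite -ball_normE /= -addrA opprD addNKr normrN.
  apply: le_lt_trans (ler_normD _ _) _; rewrite !normrZ !ger0_norm//.
  have h1 : a * `|u| <= s * `|u| by rewrite ler_wpM2r.
  have h2 : b * `|v| <= s * `|v| by rewrite ler_wpM2r.
  have h3 : s * (1 + `|u| + `|v|) = r / 2.
    by rewrite /s invfM mulrA -mulrA mulVf ?mulr1// gt_eqF.
  have h4 : r / 2 < r by rewrite ltr_pdivrMr// ltr_pMr// ltr1n.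
  apply: le_lt_trans h4; rewrite -h3 -addrA mulrDr mulr1 mulrDr.
  by apply: le_trans (lerD h1 h2) _; rewrite lerDr ltW.
have dU w y : U y -> differentiable F y /\ differentiable ('D_w F) y.
  by move=> Uy; split; [exact: dF|have [d _] := DF w; exact: d].
have [a [b [as_ bs E]]] := mixed_difference s0
  (fun a b ha hb => let: And3 h _ _ := rP _ (inB a b ha hb) in dU u _ h).
have inB' (a' b' : R) : 0 <= a' <= s -> 0 <= b' <= s ->
    ball x r (x + a' *: v + b' *: u).
  by move=> ha hb; rewrite addrAC; apply: inB.
have [b' [a' [bs' as' E']]] := mixed_difference s0
  (fun a b ha hb => let: And3 h _ _ := rP _ (inB' a b ha hb) in dU v _ h).
have cancel_square (A B p q r' t : R) : p - q - (r' - t) = A * s * s ->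
    p - r' - (q - t) = B * s * s -> A = B.
  move=> hA hB; have sn : s != 0 by rewrite gt_eqF.
  apply: (mulIf sn); apply: (mulIf sn); rewrite -hA -hB; ring.
rewrite (addrAC x (s *: v)) in E'.
have EE := cancel_square _ _ _ _ _ _ E E'.
have [_ A1 _] := rP _ (inB _ _ as_ bs); have [_ _ A2] := rP _ (inB' _ _ bs' as').
rewrite EE in A1.
exact: dist_lt_half A1 A2.
Qed.

End SecondDerivatives.

Section SmoothNear.
Context {R : realType}.
Implicit Types V W : normedModType R.

Lemma open_setI_preimage (T T' : topologicalType) (f : T -> T') (U : set T)
    (U' : set T') : open U -> open U' -> (forall x, U x -> {for x, continuous f}) ->
  open (U `&` f @^-1` U').
Proof.
move=> Uo U'o cf; rewrite openE => x [Ux fx]; apply: filterI.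
  exact: open_nbhs_nbhs.
by apply: cf => //; exact: open_nbhs_nbhs.
Qed.

Lemma smooth_near_eq V W (f g : V -> W) x :
  (\forall y \near x, f y = g y) -> smooth_near f x -> smooth_near g x.
Proof.
move=> fg [U [Uo Ux sf]]; exists (U `&` [set y | f y = g y]°); split.
- by apply: openI => //; exact: open_interior.
- by split.
- move=> k; apply: Ck_eq (Ck_sub (@subIsetl _ _ _) (sf k)).
    by apply: openI => //; exact: open_interior.
  by move=> y [_ /interior_subset].
Qed.

Lemma smooth_near_open V W (f : V -> W) x :
  smooth_near f x -> \forall y \near x, smooth_near f y.
Proof.
move=> [U [Uo Ux sf]]; apply: filterS (open_nbhs_nbhs (conj Uo Ux)) => y Uy.
by exists U.
Qed.

Lemma smooth_near_diff V W (f : V -> W) x : smooth_near f x -> differentiable f x.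
Proof. by move=> [U [Uo Ux sf]]; exact: Ck_diff (sf 1) Ux. Qed.

Lemma smooth_near_derive V W (f : V -> W) x v :
  smooth_near f x -> smooth_near ('D_v f) x.
Proof. by move=> [U [Uo Ux sf]]; exists U; split=> // k; exact: Ck_derive (sf k.+1). Qed.

Lemma smooth_near_d V W (f : V -> W) x v :
  smooth_near f x -> smooth_near (fun y => 'd f y v) x.
Proof.
move=> sf; apply: smooth_near_eq (smooth_near_derive v sf).
by apply: filterS (smooth_near_open sf) => y /smooth_near_diff dy; apply: deriveE.
Qed.

Lemma smooth_near_cst V W (a : W) (x : V) : smooth_near (cst a) x.
Proof. by exists setT; split=> //; [exact: openT|move=> k; exact: Ck_cst]. Qed.

Lemma smooth_nearD V W (f g : V -> W) x : smooth_near f x -> smooth_near g x ->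
  smooth_near (fun y => f y + g y) x.
Proof.
move=> [U [Uo Ux sf]] [U' [Uo' Ux' sg]]; exists (U `&` U').
have UUo : open (U `&` U') by exact: openI.
split=> // k; apply: CkD => //.
  exact: Ck_sub (@subIsetl _ _ _) (sf k).
exact: Ck_sub (@subIsetr _ _ _) (sg k).
Qed.

Lemma smooth_near_scale V W (a : V -> R^o) (f : V -> W) x :
  smooth_near a x -> smooth_near f x -> smooth_near (fun y => a y *: f y) x.
Proof.
move=> [U [Uo Ux sf]] [U' [Uo' Ux' sg]]; exists (U `&` U').
have UUo : open (U `&` U') by exact: openI.
split=> // k; apply: Ck_scale => //.
  exact: Ck_sub (@subIsetl _ _ _) (sf k).
exact: Ck_sub (@subIsetr _ _ _) (sg k).
Qed.

Lemma smooth_near_sum V W I (r : seq I) (f : I -> V -> W) x :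
  (forall i, smooth_near (f i) x) -> smooth_near (fun y => \sum_(i <- r) f i y) x.
Proof.
move=> sf; elim: r => [|i r IH].
  apply: smooth_near_eq (smooth_near_cst 0 x).
  by apply: nearW => y; rewrite big_nil.
apply: smooth_near_eq (smooth_nearD (sf i) IH).
by apply: nearW => y; rewrite big_cons.
Qed.

Lemma smooth_near_entry V m n (f : V -> 'M[R]_(m, n)) i j x :
  smooth_near f x -> smooth_near (fun y => f y i j : R^o) x.
Proof. by move=> [U [Uo Ux sf]]; exists U; split=> // k; exact: Ck_entry. Qed.

Lemma smooth_near_comp V W n (f : V -> 'rV[R]_n) (g : 'rV[R]_n -> W) x :
  smooth_near f x -> smooth_near g (f x) -> smooth_near (g \o f) x.
Proof.
move=> [U [Uo Ux sf]] [U' [Uo' Ux' sg]].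
have UUo : open (U `&` f @^-1` U').
  by apply: open_setI_preimage => // y Uy; exact: (sf 0).
exists (U `&` f @^-1` U'); split=> // k.
by apply: (Ck_comp UUo _ (Ck_sub (@subIsetl _ _ _) (sf k)) (sg k)) => y [].
Qed.

End SmoothNear.

(** * Smooth functions on manifolds *)

Section Charts.
Context {R : realType} {n : nat} {M : manifold R n}.
Implicit Types (c d e p q : M) (W : normedModType R).

Lemma near_chart_dom c q : chart_dom c q -> \forall q' \near q, chart_dom c q'.
Proof. by move=> cq; apply: open_nbhs_nbhs; split=> //; exact: chart_dom_open. Qed.

Lemma near_param c q (P : set M) : chart_dom c q -> (\forall q' \near q, P q') ->
  \forall x \near chart c q, P (param c x).
Proof.
move=> cq Pq; have := @param_continuous _ _ M c (chart c q) (ex_intro2 _ _ q cq erefl).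
by apply; rewrite chartK.
Qed.

Lemma near_chart c q (P : set 'rV[R]_n) : chart_dom c q ->
  (\forall x \near chart c q, P x) -> \forall q' \near q, P (chart c q').
Proof. by move=> cq Pq; apply: (chart_continuous cq Pq). Qed.

Lemma near_paramK c q : chart_dom c q ->
  \forall x \near chart c q, chart c (param c x) = x.
Proof.
move=> cq; have : nbhs (chart c q) (chart c @` chart_dom c).
  by apply: open_nbhs_nbhs; split; [exact: chart_img_open|exists q].
by apply: filterS => x [q' cq' <-]; rewrite chartK.
Qed.

Lemma transition_smooth c d q : chart_dom c q -> chart_dom d q ->
  smooth_near (chart d \o param c) (chart c q).
Proof.
move=> cq dq; exists ((chart c @` chart_dom c) `&` param c @^-1` chart_dom d); split.
- apply: open_setI_preimage; [exact: chart_img_open|exact: chart_dom_open|].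
  exact: param_continuous.
- by split; [exists q|rewrite /= chartK].
- move=> k; apply: Ck_sub (@chart_smooth _ _ M c d k) => x [[q' cq' <-]] /=.
  by rewrite chartK// => dq'; exists q'.
Qed.

Lemma chart_changeE W (f : M -> W) c d q : chart_dom c q -> chart_dom d q ->
  \forall x \near chart c q,
    ((f \o param d) \o (chart d \o param c)) x = (f \o param c) x.
Proof.
move=> cq dq; apply: filterS (near_param cq (near_chart_dom dq)) => x dx /=.
by rewrite chartK.
Qed.

Lemma smooth_near_chart W (f : M -> W) c d q : chart_dom c q -> chart_dom d q ->
  smooth_near (f \o param d) (chart d q) -> smooth_near (f \o param c) (chart c q).
Proof.
move=> cq dq sf; apply: smooth_near_eq (chart_changeE f cq dq) _.
apply: smooth_near_comp; first exact: transition_smooth.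
by rewrite /= chartK.
Qed.

(** Smoothness at [q] is defined in the chart of [q], unrelated to those of its neighbours. Being
    able to test it in any chart around [q] lets one fixed chart serve all nearby points. *)
Lemma smooth_atE W (f : M -> W) c q : chart_dom c q ->
  smooth_at f q <-> smooth_near (f \o param c) (chart c q).
Proof.
by move=> cq; split; apply: smooth_near_chart => //; exact: chart_dom_center.
Qed.

Lemma diff_chart W (f : M -> W) c d q : chart_dom c q -> chart_dom d q ->
  differentiable (f \o param d) (chart d q) ->
  differentiable (f \o param c) (chart c q) /\
  forall u, 'd (f \o param c) (chart c q) u =
            'd (f \o param d) (chart d q) (coord_change c d q u).
Proof.
move=> cq dq df; have dt := smooth_near_diff (transition_smooth cq dq).
have df' : differentiable (f \o param d) ((chart d \o param c) (chart c q)).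
  by rewrite /= chartK.
have [d1 d2] := near_eq_diff (chart_changeE f cq dq) (differentiable_comp dt df').
split=> [|u]; first exact: d1.
apply: etrans (congr1 (fun h => h u) d2) _.
by apply: etrans (congr1 (fun h => h u) (diff_comp dt df')) _; rewrite /= chartK.
Qed.

(** The cocycle rule is [diff_chart] for the function [chart e]. *)
Lemma coord_change_comp c d e q u : chart_dom c q -> chart_dom d q ->
  chart_dom e q -> coord_change d e q (coord_change c d q u) = coord_change c e q u.
Proof.
move=> cq dq eq; have dt := smooth_near_diff (transition_smooth dq eq).
by have [_ h] := diff_chart cq dq dt; exact/esym/h.
Qed.

Lemma coord_change_id c q u : chart_dom c q -> coord_change c c q u = u.
Proof.
move=> cq; have [_ h] := near_eq_diff (f := id) (g := chart c \o param c)
  (filterS (fun x h => esym h) (near_paramK cq)) ex_diff.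
apply: etrans (congr1 (fun h => h u) h) _.
exact: (congr1 (fun h => h u) (@diff_val _ _ _ _ _ _ _ (is_diff_id (chart c q)))).
Qed.

Lemma coord_changeK c d q u : chart_dom c q -> chart_dom d q ->
  coord_change d c q (coord_change c d q u) = u.
Proof. by move=> cq dq; rewrite coord_change_comp// coord_change_id. Qed.

Lemma coord_change_sum c d q u : coord_change c d q u =
  \sum_(i < n) u 0 i *: coord_change c d q (delta_mx 0 i).
Proof. exact: diff_basis. Qed.

Lemma coord_change_smooth c d q u : chart_dom c q -> chart_dom d q ->
  smooth_at (fun q' => coord_change c d q' u) q.
Proof.
move=> cq dq; apply/(smooth_atE _ cq).
apply: smooth_near_eq (smooth_near_d u (transition_smooth cq dq)).
by apply: filterS (near_paramK cq) => x; rewrite /= /coord_change => ->.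
Qed.

End Charts.

Section SmoothAt.
Context {R : realType} {n : nat} {M : manifold R n}.
Implicit Types (c p q : M) (W : normedModType R).

Lemma near_smooth_at W (f : M -> W) p :
  smooth_at f p -> \forall q \near p, smooth_at f q.
Proof.
move=> sf; have pp := chart_dom_center p.
have h := near_chart pp (smooth_near_open sf).
by apply: filterS2 h (near_chart_dom pp) => q h1 h2; apply/(smooth_atE _ h2).
Qed.

Lemma smooth_at_eq W (f g : M -> W) p :
  (\forall q \near p, f q = g q) -> smooth_at f p -> smooth_at g p.
Proof. by move=> fg; apply: smooth_near_eq (near_param (chart_dom_center p) fg). Qed.

Lemma smooth_at_chart c p : chart_dom c p -> smooth_at (chart c) p.
Proof. by move=> cp; apply: transition_smooth (chart_dom_center p) cp. Qed.

Lemma smooth_at_cst W (a : W) p : smooth_at (cst a : M -> W) p.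
Proof. exact: smooth_near_cst. Qed.

Lemma smooth_atD W (f g : M -> W) p : smooth_at f p -> smooth_at g p ->
  smooth_at (fun q => f q + g q) p.
Proof. exact: smooth_nearD. Qed.

Lemma smooth_at_scale W (a : M -> R^o) (f : M -> W) p :
  smooth_at a p -> smooth_at f p -> smooth_at (fun q => a q *: f q) p.
Proof. exact: smooth_near_scale. Qed.

Lemma smooth_at_sum W I (r : seq I) (f : I -> M -> W) p :
  (forall i, smooth_at (f i) p) -> smooth_at (fun q => \sum_(i <- r) f i q) p.
Proof. exact: smooth_near_sum. Qed.

Lemma smooth_at_entry k m (f : M -> 'M[R]_(k, m)) i j p :
  smooth_at f p -> smooth_at (fun q => f q i j : R^o) p.
Proof. exact: smooth_near_entry. Qed.

Lemma near_eq_dir_der (f g : M -> R) p u :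
  (\forall q \near p, f q = g q) -> smooth_at (f : M -> R^o) p ->
  dir_der g p u = dir_der f p u.
Proof.
move=> fg /smooth_near_diff sf.
by have [_] := near_eq_diff (near_param (chart_dom_center p) fg) sf; rewrite /dir_der => ->.
Qed.

Lemma dir_der_cst (a : R) (p : M) u : dir_der (cst a) p u = 0.
Proof. by rewrite /dir_der (_ : _ \o _ = cst a)// diff_cst. Qed.

Lemma dir_derM (f g : M -> R) p u : smooth_at (f : M -> R^o) p ->
  smooth_at (g : M -> R^o) p ->
  dir_der (fun q => f q * g q) p u = dir_der f p u * g p + f p * dir_der g p u.
Proof.
move=> /smooth_near_diff sf /smooth_near_diff sg.
have [_ h] := is_diff_scale sf sg; have := h u.
by rewrite /dir_der /= chartK //; exact: chart_dom_center.
Qed.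

End SmoothAt.

(** * Vector fields along a map *)

Section FieldsAlong.
Context {R : realType} {n m : nat} {M : manifold R n} {M' : manifold R m}.
Variable h : M -> M'.
Hypothesis sh : smooth_map h.
Implicit Types (p q : M) (c d : M') (V W : M -> 'rV[R]_m).

(** The vector [V q] is stored in the chart of [h q], which varies with [q]; read in a fixed chart
    [c] it becomes a function that can be differentiated. *)
Definition components V c q : 'rV[R]_m := coord_change (h q) c (h q) (V q).

Lemma near_map_dom c p : chart_dom c (h p) -> \forall q \near p, chart_dom c (h q).
Proof. by move=> cp; apply: (sh.1 p); exact: near_chart_dom. Qed.

Lemma near_map_comp (W : normedModType R) (F : M' -> W) p :
  \forall x \near chart p p,
    ((F \o param (h p)) \o (chart (h p) \o h \o param p)) x = ((F \o h) \o param p) x.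
Proof.
have pp := chart_dom_center p.
apply: filterS (near_param pp (near_map_dom (chart_dom_center (h p)))) => x hx /=.
by rewrite chartK.
Qed.

Lemma smooth_at_comp (W : normedModType R) (F : M' -> W) p :
  smooth_at F (h p) -> smooth_at (F \o h) p.
Proof.
move=> sF; apply: smooth_near_eq (near_map_comp F p) _.
apply: smooth_near_comp (sh.2 p) _.
by rewrite /= chartK; [exact: sF|exact: chart_dom_center].
Qed.

Lemma diff_map (W : normedModType R) (F : M' -> W) p u : smooth_at F (h p) ->
  'd ((F \o h) \o param p) (chart p p) u =
  'd (F \o param (h p)) (chart (h p) (h p)) (dmap h p u).
Proof.
move=> sF; have dh := smooth_near_diff (sh.2 p).
have dF : differentiable (F \o param (h p)) ((chart (h p) \o h \o param p) (chart p p)).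
  by rewrite /= chartK; [exact: smooth_near_diff sF|exact: chart_dom_center].
have [_ e] := near_eq_diff (near_map_comp F p) (differentiable_comp dh dF).
apply: etrans (congr1 (fun g => g u) e) _.
apply: etrans (congr1 (fun g => g u) (diff_comp dh dF)) _.
by rewrite /= chartK; [|exact: chart_dom_center].
Qed.

Lemma dir_der_map (f : M' -> R) p u : smooth_at (f : M' -> R^o) (h p) ->
  dir_der (f \o h) p u = dir_der f (h p) (dmap h p u).
Proof. exact: diff_map. Qed.

Lemma components_change V c d q : chart_dom c (h q) -> chart_dom d (h q) ->
  components V d q =
  \sum_(i < m) components V c q 0 i *: coord_change c d (h q) (delta_mx 0 i).
Proof.
move=> cq dq; rewrite -coord_change_sum /components coord_change_comp//.
exact: chart_dom_center.
Qed.

(** Components in two charts differ by the coefficients of [coord_change], which are smooth along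
    [h]. *)
Lemma smooth_alongE V c p : chart_dom c (h p) ->
  smooth_along_at h V p <-> smooth_at (components V c) p.
Proof.
suff H d e : chart_dom d (h p) -> chart_dom e (h p) ->
    smooth_at (components V d) p -> smooth_at (components V e) p.
  by move=> cp; split; apply: H => //; exact: chart_dom_center.
move=> dp ep sV.
apply: (@smooth_at_eq _ _ _ _ (fun q => \sum_(i < m) components V d q 0 i *:
    coord_change d e (h q) (delta_mx 0 i))).
  apply: filterS2 (near_map_dom dp) (near_map_dom ep) => q dq eq.
  exact/esym/components_change.
apply: smooth_at_sum => i; apply: smooth_at_scale; first exact: smooth_at_entry.
exact: (smooth_at_comp (coord_change_smooth _ dp ep)).
Qed.

Lemma smooth_alongP V p :
  smooth_along_at h V p <-> smooth_at (components V (h p)) p.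
Proof. by []. Qed.

Lemma smooth_components V p : smooth_along_at h V p -> smooth_at (components V (h p)) p.
Proof. by move/smooth_alongP. Qed.

Lemma near_smooth_along V p :
  smooth_along_at h V p -> \forall q \near p, smooth_along_at h V q.
Proof.
move=> sV; have hp := chart_dom_center (h p).
apply: filterS2 (near_smooth_at (smooth_components sV)) (near_map_dom hp) => q h1 h2.
exact/(smooth_alongE V h2).
Qed.

Lemma smooth_along_eq V W p : (\forall q \near p, V q = W q) ->
  smooth_along_at h V p -> smooth_along_at h W p.
Proof.
move=> VW /smooth_components sV; apply/smooth_alongP; apply: smooth_at_eq sV.
by apply: filterS VW => q; rewrite /components => ->.
Qed.

Lemma smooth_alongD V W p : smooth_along_at h V p -> smooth_along_at h W p ->
  smooth_along_at h (fun q => V q + W q) p.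
Proof.
move=> /smooth_components sV /smooth_components sW.
apply/smooth_alongP; apply: smooth_at_eq (smooth_atD sV sW); apply: nearW => q.
by rewrite /components -raddfD.
Qed.

Lemma smooth_along_scale (f : M -> R) V p : smooth_at (f : M -> R^o) p ->
  smooth_along_at h V p -> smooth_along_at h (fun q => f q *: V q) p.
Proof.
move=> sf /smooth_components sV.
apply/smooth_alongP; apply: smooth_at_eq (smooth_at_scale sf sV); apply: nearW => q.
by rewrite /components -linearZ.
Qed.

Lemma smooth_along_sum I (r : seq I) (V : I -> M -> 'rV[R]_m) p :
  (forall i, smooth_along_at h (V i) p) ->
  smooth_along_at h (fun q => \sum_(i <- r) V i q) p.
Proof.
move=> sV; apply/smooth_alongP.
apply: (smooth_at_eq (f := fun q => \sum_(i <- r) components (V i) (h p) q)).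
  by apply: nearW => q; rewrite /components -linear_sum.
by apply: smooth_at_sum => i; exact: smooth_components.
Qed.

Lemma components_frame V c q : chart_dom c (h q) ->
  V q = \sum_(k < m) components V c q 0 k *: coord_field c (delta_mx 0 k) (h q).
Proof.
move=> cq; rewrite -coord_change_sum /components coord_changeK//.
exact: chart_dom_center.
Qed.

Lemma components_center V p : components V (h p) p = V p.
Proof. exact: coord_change_id (chart_dom_center _). Qed.

Lemma local_rep_center V p : local_rep h V p (chart p p) = V p.
Proof.
rewrite /local_rep /= chartK; last exact: chart_dom_center.
exact: components_center.
Qed.

End FieldsAlong.

Section FieldsOn.
Context {R : realType} {n : nat} {M : manifold R n}.
Implicit Types (p q c : M) (X Y : M -> 'rV[R]_n).

Lemma smooth_map_id : smooth_map (fun q : M => q).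
Proof.
split=> [|p]; first by move=> p.
exact: smooth_at_chart (chart_dom_center p).
Qed.

Lemma coord_field_smooth c u q : chart_dom c q -> smooth_field_at (coord_field c u) q.
Proof.
move=> cq; apply/(smooth_alongE smooth_map_id _ cq).
apply: smooth_at_eq (smooth_at_cst u q).
apply: filterS (near_chart_dom cq) => q' cq'.
by rewrite /components /coord_field coord_changeK//; exact: chart_dom_center.
Qed.

Lemma coord_field_center c u : coord_field c u c = u.
Proof. exact: coord_change_id (chart_dom_center c). Qed.

Lemma coord_field_sum c u :
  coord_field c u = fun q => \sum_(i < n) u 0 i *: coord_field c (delta_mx 0 i) q.
Proof. by apply/funext => q; exact: coord_change_sum. Qed.

Lemma coord_fieldD c u v :
  coord_field c (u + v) = fun q => coord_field c u q + coord_field c v q.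
Proof. by apply/funext => q; rewrite /coord_field /coord_change raddfD. Qed.

Lemma coord_fieldZ c a u :
  coord_field c (a *: u) = fun q => a *: coord_field c u q.
Proof. by apply/funext => q; rewrite /coord_field /coord_change linearZ. Qed.

(** In the chart [c] both fields have constant components near the centre, so both differentials
    vanish. *)
Lemma lie_bracket_coord_field c u v : lie_bracket (coord_field c u) (coord_field c v) c = 0.
Proof.
have d0 w z : 'd (local_rep (fun q : M => q) (coord_field c w) c) (chart c c) z = 0.
  have cc := chart_dom_center c.
  have e : \forall x \near chart c c,
      cst w x = local_rep (fun q : M => q) (coord_field c w) c x.
    apply: filterS (near_param cc (near_chart_dom cc)) => x cx.
    by rewrite /local_rep /= /coord_field coord_changeK//; exact: chart_dom_center.
  have [_ d] := near_eq_diff e (differentiable_cst w _).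
  by rewrite d diff_cst.
by apply: etrans (congr2 (fun a b => a - b) (d0 v _) (d0 u _)) _; rewrite subr0.
Qed.

Lemma smooth_along_field m (M' : manifold R m) (h : M -> M') (W : M' -> 'rV[R]_m) p :
  smooth_map h -> smooth_field_at W (h p) -> smooth_along_at h (fun q => W (h q)) p.
Proof.
by move=> sh /smooth_components sW; exact: (smooth_at_comp sh sW).
Qed.

End FieldsOn.

(** * Connections and their pullbacks *)

Lemma smooth_along0 (R : realType) (n m : nat) (M : manifold R n)
    (M' : manifold R m) (h : M -> M') p : smooth_along_at h (fun=> 0) p.
Proof.
apply/smooth_alongP; apply: smooth_at_eq (smooth_at_cst 0 p).
by apply: nearW => q; rewrite /components /coord_change linear0.
Qed.

Section ConnectionOn.
Context {R : realType} {n : nat} {M : manifold R n} (D : connection M).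
Implicit Types (c p q : M) (u v : 'rV[R]_n) (X Y : M -> 'rV[R]_n).

Lemma coord_field_center_smooth c v : smooth_field_at (coord_field c v) c.
Proof. exact: coord_field_smooth (chart_dom_center c). Qed.

Lemma connection_cst p a Y u : smooth_field_at Y p ->
  D p u (fun q => a *: Y q) = a *: D p u Y.
Proof.
move=> sY; have := connection_leibniz D (smooth_at_cst a p) sY u.
by rewrite dir_der_cst scale0r add0r.
Qed.

Lemma connection_sum p I (r : seq I) (Y : I -> M -> 'rV[R]_n) u :
  (forall i, smooth_field_at (Y i) p) ->
  D p u (fun q => \sum_(i <- r) Y i q) = \sum_(i <- r) D p u (Y i).
Proof.
move=> sY; elim: r => [|i r IH].
  (* The empty sum is presented as 0 times a smooth field, so that [connection_cst] evaluates it. *)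
  rewrite big_nil (_ : (fun q => _) = fun q => 0 *: coord_field p 0 q); last first.
    by apply/funext => q; rewrite big_nil scale0r.
  by rewrite connection_cst ?scale0r//; apply: coord_field_smooth; exact: chart_dom_center.
rewrite (_ : (fun q => _) = fun q => Y i q + \sum_(i <- r) Y i q); last first.
  by apply/funext => q; rewrite big_cons.
rewrite big_cons -IH; apply: connection_add; first exact: sY.
exact: smooth_along_sum.
Qed.

Lemma connection_dirD p Y u v : smooth_field_at Y p ->
  D p (u + v) Y = D p u Y + D p v Y.
Proof. by move=> sY; rewrite -{1}[u]scale1r connection_linear// scale1r. Qed.

Lemma connection_dir0 p Y : smooth_field_at Y p -> D p 0 Y = 0.
Proof.
move=> sY; have := connection_dirD (p := p) 0 0 sY; rewrite addr0.
by move=> e; apply: (addrI (D p 0 Y)); rewrite addr0.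
Qed.

Lemma connection_dirZ p a Y u : smooth_field_at Y p ->
  D p (a *: u) Y = a *: D p u Y.
Proof.
by move=> sY; rewrite -[a *: u]addr0 connection_linear// connection_dir0// addr0.
Qed.

Lemma connection_dir_sum p Y I (r : seq I) (a : I -> R) (u : I -> 'rV[R]_n) :
  smooth_field_at Y p ->
  D p (\sum_(i <- r) a i *: u i) Y = \sum_(i <- r) a i *: D p (u i) Y.
Proof.
move=> sY; elim: r => [|i r IH]; first by rewrite !big_nil connection_dir0.
by rewrite !big_cons connection_linear// IH.
Qed.

(* Locality comes from the Leibniz rule applied to the indicator function of
   the set where the two fields differ, which is smooth at [p] since it
   vanishes near [p]; no bump function is needed. *)
Lemma connection_near p Y Y' u : (\forall q \near p, Y q = Y' q) ->
  smooth_field_at Y p -> D p u Y' = D p u Y.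
Proof.
move=> YY' sY; have sY' := smooth_along_eq YY' sY.
pose f q : R := if `[< Y q = Y' q >] then 0 else 1.
have f0 : \forall q \near p, cst 0 q = f q.
  by apply: filterS YY' => q e; rewrite /f asboolT.
have sf : smooth_at (f : M -> R^o) p := smooth_at_eq f0 (smooth_at_cst 0 p).
have sB : smooth_field_at (fun q => Y' q + (-1) *: Y q) p.
  by apply: smooth_alongD => //; apply: smooth_along_scale => //; exact: smooth_at_cst.
have Bf : (fun q => Y' q + (-1) *: Y q) = fun q => f q *: (Y' q + (-1) *: Y q).
  apply/funext => q; rewrite /f; case: asboolP => [->|_]; last by rewrite scale1r.
  by rewrite scaleN1r subrr scaler0.
have B0 : D p u (fun q => Y' q + (-1) *: Y q) = 0.
  rewrite Bf connection_leibniz// -(nbhs_singleton f0) (nbhs_singleton YY').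
  by rewrite scaleN1r subrr scaler0 scale0r addr0.
have -> : Y' = fun q => Y q + (Y' q + (-1) *: Y q).
  by apply/funext => q; rewrite scaleN1r addrC subrK.
by rewrite connection_add// B0 addr0.
Qed.

(** The formula that defines [derivative_along], here for the identity map: expand [W] in the
    coordinate frame, apply the Leibniz rule, and regroup the undifferentiated components into a
    coordinate field. *)
Lemma connection_expand (W : M -> 'rV[R]_n) p u : smooth_field_at W p ->
  D p u W = 'd (local_rep (fun q : M => q) W p) (chart p p) u +
            D p u (coord_field p (W p)).
Proof.
move=> sW; have sc := smooth_components sW; have pp := chart_dom_center p.
have e : \forall q \near p,
    \sum_(k < n) components id W p q 0 k *: coord_field p (delta_mx 0 k) q = W q.
  by apply: filterS (near_chart_dom pp) => q pq; rewrite -(components_frame (h := id) W pq).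
have sk k : smooth_at (fun q => components id W p q 0 k : R^o) p.
  exact: smooth_at_entry sc.
have st k : smooth_field_at
    (fun q => components id W p q 0 k *: coord_field p (delta_mx 0 k) q) p.
  apply: smooth_along_scale; first exact: sk.
  exact: coord_field_smooth.
rewrite (connection_near u e) ?connection_sum//; last exact: smooth_along_sum.
under eq_bigr => k _ do rewrite (connection_leibniz D (sk k) (coord_field_smooth _ pp)).
rewrite big_split /= [X in _ + X = _](_ : _ = D p u (coord_field p (W p))); last first.
  rewrite coord_field_sum connection_sum => [|k]; last first.
    apply: smooth_along_scale; first exact: smooth_at_cst.
    exact: coord_field_smooth.
  apply: eq_bigr => k _; rewrite connection_cst; last exact: coord_field_smooth.
  by rewrite (components_center (fun q : M => q)).
congr (_ + _); rewrite [RHS]row_sum_delta; apply: eq_bigr => k _.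
rewrite coord_field_center; congr (_ *: _).
have [_ d] := diff_entry 0 k (smooth_near_diff sc); exact: d.
Qed.

End ConnectionOn.

Section DerivativeAlong.
Context {R : realType} {n : nat} {M : manifold R n} {M' : manifold R n.+1}.
Variables (h : M -> M') (D : connection M').
Hypothesis sh : smooth_map h.
Implicit Types (p q : M) (u v : 'rV[R]_n) (V W : M -> 'rV[R]_n.+1).

Local Notation P := (derivative_along h D).

Lemma along_near p u V W : (\forall q \near p, V q = W q) ->
  smooth_along_at h V p -> P p u W = P p u V.
Proof.
move=> VW /smooth_near_diff dV; rewrite /derivative_along (nbhs_singleton VW).
have e := near_param (chart_dom_center p) VW.
have e' : \forall x \near chart p p, local_rep h V p x = local_rep h W p x.
  by apply: filterS e => x; rewrite /local_rep /= => ->.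
have [_ d] := near_eq_diff e' dV.
exact: (congr2 +%R (congr1 (fun g => g u) d) erefl).
Qed.

Lemma alongD p u V W : smooth_along_at h V p -> smooth_along_at h W p ->
  P p u (fun q => V q + W q) = P p u V + P p u W.
Proof.
move=> /smooth_near_diff dV /smooth_near_diff dW.
rewrite /derivative_along coord_fieldD connection_add; try exact: coord_field_center_smooth.
rewrite addrACA; apply: (congr2 +%R _ erefl).
have -> : local_rep h (fun q => V q + W q) p = local_rep h V p + local_rep h W p.
  by apply/funext => x; rewrite !fctE /local_rep /= /coord_change raddfD.
exact: (congr1 (fun g => g u) (diffD dV dW)).
Qed.

Lemma along_scale p u (f : M -> R) V : smooth_at (f : M -> R^o) p ->
  smooth_along_at h V p ->
  P p u (fun q => f q *: V q) = dir_der f p u *: V p + f p *: P p u V.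
Proof.
move=> sf sV; have df := smooth_near_diff sf; have dV := smooth_near_diff sV.
rewrite /derivative_along coord_fieldZ connection_cst; last exact: coord_field_center_smooth.
rewrite scalerDr addrA; apply: (congr2 +%R _ erefl).
have -> : local_rep h (fun q => f q *: V q) p =
    (fun x => (f \o param p) x *: local_rep h V p x).
  by apply/funext => x; rewrite /local_rep /= /coord_change linearZ.
have [_ e] := is_diff_scale df dV.
apply: etrans (e u) _; rewrite local_rep_center /= chartK//.
exact: chart_dom_center.
Qed.

Lemma along_sum p u I (r : seq I) (V : I -> M -> 'rV[R]_n.+1) :
  (forall i, smooth_along_at h (V i) p) ->
  P p u (fun q => \sum_(i <- r) V i q) = \sum_(i <- r) P p u (V i).
Proof.
move=> sV; elim: r => [|i r IH].
  rewrite big_nil (_ : (fun q => _) = fun q => 0 *: (0 : 'rV[R]_n.+1)); last first.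
    by apply/funext => q; rewrite big_nil scale0r.
  rewrite (along_scale u (smooth_at_cst 0 p) (smooth_along0 h p)) scale0r addr0.
  by rewrite scaler0.
rewrite (_ : (fun q => _) = fun q => V i q + \sum_(i <- r) V i q); last first.
  by apply/funext => q; rewrite big_cons.
by rewrite big_cons -IH; apply: alongD; [exact: sV|exact: smooth_along_sum].
Qed.

Lemma along_comp p u (W : M' -> 'rV[R]_n.+1) : smooth_field_at W (h p) ->
  P p u (fun q => W (h q)) = D (h p) (dmap h p u) W.
Proof.
move=> sW; rewrite (connection_expand D _ sW) /P; apply: (congr2 +%R _ erefl).
exact: (diff_map sh u (smooth_components sW)).
Qed.

End DerivativeAlong.

(** * Lie brackets *)

Section Brackets.
Context {R : realType}.

Lemma diff_fsum (V W : normedModType R) I (r : seq I) (f : I -> V -> W) x :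
  (forall i, differentiable (f i) x) ->
  differentiable (fun y => \sum_(i <- r) f i y) x /\
  forall v, 'd (fun y => \sum_(i <- r) f i y) x v = \sum_(i <- r) 'd (f i) x v.
Proof.
move=> df; elim: r => [|i r [IH1 IH2]].
  rewrite (_ : (fun y => _) = cst 0); last by apply/funext => y; rewrite big_nil.
  split=> [|v]; first exact: differentiable_cst.
  by rewrite diff_cst big_nil.
rewrite (_ : (fun y => _) = f i + (fun y => \sum_(i <- r) f i y)); last first.
  by apply/funext => y; rewrite big_cons.
split=> [|v]; first exact: differentiableD.
apply: etrans (congr1 (fun g => g v) (diffD (df i) IH1)) _.
by rewrite big_cons -IH2.
Qed.

(** The product rule for the sum of the [G_i] times the partial derivatives of [F]. In its second
    half [derive_comm] moves ['D_w] inside, which leaves a derivative in direction [G x]. *)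
Lemma diff_dir n (F : 'rV[R]_n -> R^o) (G : 'rV[R]_n -> 'rV[R]_n) x w :
  smooth_near F x -> smooth_near G x ->
  'd (fun y => 'd F y (G y)) x w =
  'd F x ('d G x w) + 'D_(G x) ('D_w F) x.
Proof.
move=> sF sG.
have dG i : differentiable (fun y => G y 0 i : R^o) x /\
    forall v, 'd (fun y => G y 0 i : R^o) x v = 'd G x v 0 i.
  exact: diff_entry (smooth_near_diff sG).
have dDF v : differentiable ('D_v F) x := smooth_near_diff (smooth_near_derive v sF).
have dterm i := is_diff_scale (dG i).1 (dDF (delta_mx 0 i)).
have [d1 d2] := diff_fsum (index_enum 'I_n) (fun i => (dterm i).1).
have e : \forall y \near x,
    \sum_(i < n) (G y 0 i : R^o) *: 'D_(delta_mx 0 i) F y = 'd F y (G y).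
  apply: filterS (smooth_near_open sF) => y /smooth_near_diff dF.
  by rewrite [RHS]diff_basis; apply: eq_bigr => i _; rewrite (deriveE _ dF).
have [_ d3] := near_eq_diff e d1.
apply: etrans (congr1 (fun g => g w) d3) _; apply: etrans (d2 w) _.
rewrite (eq_bigr _ (fun i _ => (dterm i).2 w)) big_split /=.
apply: (congr2 +%R).
  rewrite [RHS]diff_basis; apply: eq_bigr => i _.
  exact: (congr2 *:%R ((dG i).2 w) (deriveE _ (smooth_near_diff sF))).
rewrite (deriveE _ (dDF w)) [RHS]diff_basis; apply: eq_bigr => i _.
apply: (congr1 ( *:%R (G x 0 i))); apply: etrans (deriveE _ (dDF w)).
exact: etrans (esym (deriveE _ (dDF _))) (derive_comm _ _ sF).
Qed.

Context {n : nat} {M : manifold R n}.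
Implicit Types (f : M -> R) (X Y : M -> 'rV[R]_n) (p q : M).

Lemma dir_der_chart f c q u : chart_dom c q -> smooth_at (f : M -> R^o) q ->
  dir_der f q u = 'd (f \o param c : _ -> R^o) (chart c q) (coord_change q c q u).
Proof.
move=> cq /(smooth_atE _ cq)/smooth_near_diff df.
have [_ d] := diff_chart (chart_dom_center q) cq df; exact: d.
Qed.

(** The right side uses the chart of each nearby point, the left side only that of [p]; this form is
    the one to differentiate. *)
Lemma near_dir_der f Y p : smooth_at (f : M -> R^o) p ->
  \forall x \near chart p p,
    'd (f \o param p : _ -> R^o) x (local_rep (fun q : M => q) Y p x) =
    dir_der f (param p x) (Y (param p x)).
Proof.
move=> sf; have pp := chart_dom_center p.
apply: filterS3 (near_paramK pp) (near_param pp (near_chart_dom pp))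
  (near_param pp (near_smooth_at sf)) => x e px sfx.
by rewrite (dir_der_chart _ px sfx) e.
Qed.

Lemma smooth_dir_der f Y p : smooth_at (f : M -> R^o) p -> smooth_field_at Y p ->
  smooth_at (fun q => dir_der f q (Y q) : R^o) p.
Proof.
move=> sf sY; apply: smooth_near_eq (near_dir_der Y sf) _.
pose F := f \o param p : _ -> R^o.
have -> : (fun x => 'd F x (local_rep (fun q : M => q) Y p x)) = (fun x => \sum_(i < n)
    (local_rep (fun q : M => q) Y p x 0 i : R^o) *: 'd F x (delta_mx 0 i)).
  by apply/funext => x; rewrite [LHS]diff_basis.
apply: smooth_near_sum => i.
apply: smooth_near_scale; first exact: smooth_near_entry.
exact: smooth_near_d.
Qed.

(** By [diff_dir] each iterated derivative is a first-order term plus a second derivative of [f] in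
    the directions [X p], [Y p]. The latter is symmetric and cancels; the former assemble the
    bracket. *)
Lemma dir_der_bracket f X Y p : smooth_at (f : M -> R^o) p ->
  smooth_field_at X p -> smooth_field_at Y p ->
  dir_der (fun q => dir_der f q (Y q)) p (X p) -
  dir_der (fun q => dir_der f q (X q)) p (Y p) = dir_der f p (lie_bracket X Y p).
Proof.
pose F := f \o param p : _ -> R^o; pose L Z := local_rep (fun q : M => q) Z p.
move=> sf.
have E Z W : smooth_field_at Z p -> dir_der (fun q => dir_der f q (Z q)) p W =
    'd F (chart p p) ('d (L Z) (chart p p) W) + 'D_(Z p) ('D_W F) (chart p p).
  move=> sZ; have := diff_dir W sf (sZ : smooth_near (L Z) _).
  have -> : L Z (chart p p) = Z p by exact: (local_rep_center (fun q : M => q)).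
  move=> dd.
  have sd : smooth_near (fun x => 'd F x (L Z x)) (chart p p).
    apply: smooth_near_eq (smooth_dir_der sf sZ).
    by apply: filterS (near_dir_der Z sf) => x /esym.
  have [_ d] := near_eq_diff (near_dir_der Z sf) (smooth_near_diff sd).
  exact: etrans (congr1 (fun g => g W) d) dd.
move=> sX sY; rewrite !E// (derive_comm _ _ sf).
by rewrite opprD addrACA subrr addr0 -raddfB.
Qed.

End Brackets.

(* MathComp-Analysis has a homonymous operation on measures. *)
Local Notation pushforward := Defs.pushforward.

(** * Pushforward of fields and of their brackets *)

Section Pushforward.
Context {R : realType} {n m : nat} {M : manifold R n} {M' : manifold R m}.
Variable h : M -> M'.
Hypothesis sh : smooth_map h.
Implicit Types (X Y : M -> 'rV[R]_n) (p q : M) (c : M').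

(** Turns a component of a pushed-forward vector into the derivative of a scalar function, to which
    [dir_der_bracket] applies. *)
Lemma coord_change_dmap c q u j : chart_dom c (h q) ->
  coord_change (h q) c (h q) (dmap h q u) 0 j =
  dir_der (fun q => chart c (h q) 0 j) q u.
Proof.
move=> cq; have sc := smooth_at_chart cq.
rewrite /coord_change -(diff_map sh u sc).
have [_ d] := diff_entry 0 j (smooth_near_diff (smooth_at_comp sh sc)).
exact/esym/d.
Qed.

Lemma smooth_chart_map c p j : chart_dom c (h p) ->
  smooth_at (fun q => chart c (h q) 0 j : R^o) p.
Proof. by move=> cp; exact: smooth_at_entry (smooth_at_comp sh (smooth_at_chart cp)). Qed.

Lemma near_components_pushforward p Y j :
  \forall q \near p, dir_der (fun q => chart (h p) (h q) 0 j) q (Y q) =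
    components h (pushforward h Y) (h p) q 0 j.
Proof.
apply: filterS (near_map_dom sh (chart_dom_center (h p))) => q cq.
by rewrite /components /pushforward coord_change_dmap.
Qed.

Lemma pushforward_smooth Y p : smooth_field_at Y p ->
  smooth_along_at h (pushforward h Y) p.
Proof.
move=> sY; apply/smooth_alongP.
apply: (smooth_at_eq (f := fun q => \sum_(j < m)
  (components h (pushforward h Y) (h p) q 0 j : R^o) *: delta_mx 0 j)).
  by apply: nearW => q; rewrite -row_sum_delta.
apply: smooth_at_sum => j; apply: smooth_at_scale; last exact: smooth_at_cst.
apply: smooth_at_eq (near_components_pushforward p Y j) _.
apply: smooth_dir_der sY; apply: smooth_chart_map; exact: chart_dom_center.
Qed.

(** This is [dir_der_bracket] for the [j]-th ambient coordinate composed with [h]; it replaces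
    naturality of the bracket, as pushed-forward fields live only along [h]. *)
Lemma pushforward_bracket X Y p j : smooth_field_at X p -> smooth_field_at Y p ->
  dir_der (fun q => components h (pushforward h Y) (h p) q 0 j) p (X p) -
  dir_der (fun q => components h (pushforward h X) (h p) q 0 j) p (Y p) =
  dmap h p (lie_bracket X Y p) 0 j.
Proof.
move=> sX sY; have hp := chart_dom_center (h p).
have sj := smooth_chart_map j hp.
rewrite !(near_eq_dir_der _ (near_components_pushforward p _ j));
  try exact: smooth_dir_der.
rewrite (dir_der_bracket sj sX sY) -coord_change_dmap//.
by rewrite coord_change_id.
Qed.

End Pushforward.

Section MetricAlgebra.
Context {R : realType} {n : nat} {M : manifold R n} (g : metric M).
Implicit Types (p : M) (u v w : 'rV[R]_n).

Lemma metric0l p w : g p 0 w = 0.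
Proof.
apply: (addrI (g p 0 w)); rewrite addr0 -{1}[g p 0 w]mul1r -metric_linear.
by rewrite scale1r addr0.
Qed.

Lemma metricDl p u v w : g p (u + v) w = g p u w + g p v w.
Proof. by rewrite -{1}[u]scale1r metric_linear mul1r. Qed.

Lemma metricZl p a u w : g p (a *: u) w = a * g p u w.
Proof. by rewrite -[a *: u]addr0 metric_linear metric0l addr0. Qed.

Lemma metricNl p u w : g p (- u) w = - g p u w.
Proof. by rewrite -scaleN1r metricZl mulN1r. Qed.

Lemma metricBl p u v w : g p (u - v) w = g p u w - g p v w.
Proof. by rewrite metricDl metricNl. Qed.

Lemma metric_suml p I (r : seq I) (u : I -> 'rV[R]_n) w :
  g p (\sum_(i <- r) u i) w = \sum_(i <- r) g p (u i) w.
Proof.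
elim: r => [|i r IH]; first by rewrite !big_nil metric0l.
by rewrite !big_cons metricDl IH.
Qed.

Lemma metric_nondegenerate p u : (forall w, g p u w = 0) -> u = 0.
Proof.
move=> h; apply/eqP; apply: contraT => /(metric_pos g p).
by rewrite h ltxx.
Qed.

End MetricAlgebra.

Section StatisticalDuality.
Context {R : realType} {n : nat} {M : manifold R n}.
Variables (g : metric M) (D Ds : connection M).
Hypothesis (dual : dual_connection g D Ds).

Lemma dual_connection_sym : dual_connection g Ds D.
Proof.
move=> p X Y Z sX sY sZ; have e := dual sY sX sZ.
rewrite (_ : (fun q => _) = fun q => g q (Y q) (X q)).
  rewrite e addrC (Defs.metric_sym g p (Y p)) (Defs.metric_sym g p (Ds p _ X)).
  by rewrite (Defs.metric_sym g p (X p)).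
by apply/funext => q; rewrite Defs.metric_sym.
Qed.

(* The difference of the torsions of the two connections, paired with a vector
   [w], is the defect of symmetry of the cubic form [nabla g]. *)
Lemma dual_torsion_free : statistical g D -> torsion_free Ds.
Proof.
move=> [tD cubic] p X Y sX sY; rewrite -(tD p X Y sX sY).
apply/eqP; rewrite -subr_eq0; apply/eqP; apply: (metric_nondegenerate (g := g) (p := p)) => w.
pose Z := coord_field p w; have sZ : smooth_field_at Z p by exact: coord_field_center_smooth.
have Zp : Z p = w by exact: coord_field_center.
have [_ c1] := cubic p X Y Z sX sY sZ.
have [_ c2] := cubic p Y X Z sY sX sZ.
have [c3 _] := cubic p X Y Z sX sY sZ.
(* By duality [(nabla_X g)(Z, Y)] is [g(Z, Ds_X Y - D_X Y)], and likewise with [X] and [Y]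
   exchanged, so the cubic symmetries compare the two torsions. *)
have e1 := dual sZ sY sX; have e2 := dual sZ sX sY.
move: c1 c2 c3; rewrite /nabla_metric e1 e2 Zp !metricBl.
rewrite !(Defs.metric_sym g p _ w).
move: (g p w (Ds p (X p) Y)) (g p w (Ds p (Y p) X)) (g p w (D p (X p) Y)).
move: (g p w (D p (Y p) X)) => a b c d.
rewrite !(Defs.metric_sym g p (D p _ Z)).
move: (g p (Y p) (D p (X p) Z)) (g p (X p) (D p (Y p) Z)) => s t.
move: (dir_der _ _ _) (dir_der _ _ _) => s' t'; lra.
Qed.

End StatisticalDuality.

(** The cancellation behind tensoriality of curvature in its last argument: [a] is the value of a
    function, [x], [y], [xy], [yx] are its first and iterated derivatives, and [v], [vx], [vy] are a
    field and its derivatives. *)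
Lemma leibniz_commutator (R : realType) n (x y xy yx a : R)
    (v vx vy A B C : 'rV[R]_n) :
  xy *: v + y *: vx + (x *: vy + a *: A) - (yx *: v + x *: vy + (y *: vx + a *: B)) -
  ((xy - yx) *: v + a *: C) = a *: (A - B - C).
Proof. by apply/rowP => i; rewrite !mxE; ring. Qed.

(** * Curvature of the ambient connection and of its pullback *)

Section CurvatureTensor.

Local Notation E c k := (coord_field c (delta_mx 0 k)).

(** The coefficients are constant, so no Leibniz terms arise; but the inner derivative has to be
    expanded on a neighbourhood of [c] before the outer one is taken. *)
Lemma curvature_tensor_sum (R : realType) n (M : manifold R n)
    (D : connection M) (c : M) (u v w : 'rV[R]_n) :
  curvature_tensor D c u v w =
  \sum_(k < n) w 0 k *: curvature_tensor D c u v (delta_mx 0 k).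
Proof.
have cc := chart_dom_center c.
have sf v' : smooth_field_at (coord_field c v') c by exact: coord_field_center_smooth.
have expand (q : M) u' : chart_dom c q -> \sum_(k < n) w 0 k *: D q u' (E c k) =
    D q u' (coord_field c w).
  move=> cq; rewrite coord_field_sum connection_sum => [|k]; last first.
    apply: smooth_along_scale; first exact: smooth_at_cst.
    exact: coord_field_smooth.
  by apply: eq_bigr => k _; rewrite connection_cst//; exact: coord_field_smooth.
have second u' v' : D c u' (fun q => D q (coord_field c v' q) (coord_field c w)) =
    \sum_(k < n) w 0 k *: D c u' (fun q => D q (coord_field c v' q) (E c k)).
  have e : \forall q \near c,
      \sum_(k < n) w 0 k *: D q (coord_field c v' q) (E c k) =
      D q (coord_field c v' q) (coord_field c w).
    by apply: filterS (near_chart_dom cc) => q; exact: expand.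
  have sk k : smooth_field_at (fun q => D q (coord_field c v' q) (E c k)) c.
    exact: connection_smooth.
  have st k : smooth_field_at (fun q => w 0 k *: D q (coord_field c v' q) (E c k)) c.
    by apply: smooth_along_scale (sk k); exact: smooth_at_cst.
  rewrite (connection_near D _ e (smooth_along_sum _ st)) connection_sum//.
  by apply: eq_bigr => k _; rewrite connection_cst.
rewrite /curvature_tensor /curvature !second -expand//.
rewrite -!sumrB; apply: eq_bigr => k _.
by rewrite !scalerBr.
Qed.

End CurvatureTensor.

Section AlongTheory.
Context {R : realType} {n : nat} {M : manifold R n} {M' : manifold R n.+1}.
Variables (h : M -> M') (D : connection M').
Hypothesis sh : smooth_map h.
Implicit Types (p q : M) (u v : 'rV[R]_n) (V W : M -> 'rV[R]_n.+1).
Implicit Types (X Y : M -> 'rV[R]_n).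

Local Notation P := (derivative_along h D).
Local Notation E c k := (coord_field c (delta_mx 0 k)).

Lemma near_frame V p : \forall q \near p,
  \sum_(k < n.+1) components h V (h p) q 0 k *: E (h p) k (h q) = V q.
Proof.
apply: filterS (near_map_dom sh (chart_dom_center (h p))) => q cq.
exact/esym/components_frame.
Qed.

Lemma smooth_frame_along p (q : M) (v : 'rV[R]_n.+1) : chart_dom (h p) (h q) ->
  smooth_along_at h (fun q => coord_field (h p) v (h q)) q.
Proof. by move=> cq; apply: smooth_along_field => //; exact: coord_field_smooth. Qed.

Lemma smooth_component V p k : smooth_along_at h V p ->
  smooth_at (fun q => components h V (h p) q 0 k : R^o) p.
Proof. by move/smooth_components; exact: smooth_at_entry. Qed.

(** Coordinate fields commute, so torsion-freeness cancels the connection terms; the differentiated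
    components form the bracket by [pushforward_bracket]. *)
Lemma along_torsion X Y p : torsion_free D -> smooth_field_at X p -> smooth_field_at Y p ->
  P p (X p) (pushforward h Y) - P p (Y p) (pushforward h X) =
  dmap h p (lie_bracket X Y p).
Proof.
move=> tD sX sY; rewrite /derivative_along opprD addrACA.
rewrite {2}/pushforward {3}/pushforward.
have := tD (h p) _ _ (coord_field_center_smooth (h p) (dmap h p (X p)))
  (coord_field_center_smooth (h p) (dmap h p (Y p))).
rewrite !coord_field_center lie_bracket_coord_field => ->; rewrite addr0.
apply/rowP => j; rewrite -(pushforward_bracket sh j sX sY) !mxE.
have ent Z w : smooth_field_at Z p ->
    'd (local_rep h (pushforward h Z) p) (chart p p) w 0 j =
    dir_der (fun q => components h (pushforward h Z) (h p) q 0 j) p w.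
  move=> /(pushforward_smooth sh)/smooth_near_diff dZ.
  by have [_ d] := diff_entry 0 j dZ; exact/esym/d.
exact: (congr2 (fun a b => a - b) (ent Y (X p) sY) (ent X (Y p) sX)).
Qed.

(** Moves the dependence on [q] into scalar components and restrictions of ambient fields, both of
    which can be differentiated again. *)
Lemma near_along_comp p (v : 'rV[R]_n.+1) Y : \forall q \near p,
  P q (Y q) (fun q => coord_field (h p) v (h q)) =
  \sum_(j < n.+1) components h (pushforward h Y) (h p) q 0 j *:
    D (h q) (E (h p) j (h q)) (coord_field (h p) v).
Proof.
apply: filterS2 (near_map_dom sh (chart_dom_center (h p)))
  (near_frame (pushforward h Y) p) => q cq e.
have sE := coord_field_smooth v cq.
by rewrite along_comp// -[dmap h q (Y q)]/(pushforward h Y q) -e connection_dir_sum.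
Qed.

Lemma smooth_connection_frame p (v : 'rV[R]_n.+1) (j : 'I_n.+1) :
  smooth_field_at (fun r => D r (E (h p) j r) (coord_field (h p) v)) (h p).
Proof. by apply: connection_smooth; exact: coord_field_center_smooth. Qed.

Lemma smooth_along_coord p (v : 'rV[R]_n.+1) Y : smooth_field_at Y p ->
  smooth_along_at h (fun q => P q (Y q) (fun q => coord_field (h p) v (h q))) p.
Proof.
move=> sY.
apply: smooth_along_eq; first by apply: filterS (near_along_comp p v Y) => q /esym e; exact: e.
apply: smooth_along_sum => j; apply: smooth_along_scale.
  exact: smooth_component (pushforward_smooth sh sY).
exact: smooth_along_field (smooth_connection_frame p v j).
Qed.

Lemma near_along_scale p (f : M -> R) V Y :
  smooth_at (f : M -> R^o) p -> smooth_along_at h V p ->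
  \forall q \near p, P q (Y q) (fun q => f q *: V q) =
    dir_der f q (Y q) *: V q + f q *: P q (Y q) V.
Proof.
move=> sf sV; apply: filterS2 (near_smooth_at sf) (near_smooth_along sh sV) => q.
exact: along_scale.
Qed.

Lemma near_alongD p V W Y : smooth_along_at h V p -> smooth_along_at h W p ->
  \forall q \near p, P q (Y q) (fun q => V q + W q) = P q (Y q) V + P q (Y q) W.
Proof.
move=> sV sW; apply: filterS2 (near_smooth_along sh sV) (near_smooth_along sh sW) => q.
exact: alongD.
Qed.

Lemma near_along_near p V W Y : (\forall q \near p, V q = W q) ->
  smooth_along_at h V p -> \forall q \near p, P q (Y q) W = P q (Y q) V.
Proof.
move=> VW sV; have := nbhs_interior VW.
by apply: filterS2 (near_smooth_along sh sV) => q; move=> s e; apply: along_near.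
Qed.

Section Curvature.
Variables (X Y : M -> 'rV[R]_n) (p : M).
Hypotheses (sX : smooth_field_at X p) (sY : smooth_field_at Y p).

(* The curvature of the connection pulled back by [h], applied to [V]. *)
Definition along_curvature V :=
  P p (X p) (fun q => P q (Y q) V) - P p (Y p) (fun q => P q (X q) V) -
  P p (lie_bracket X Y p) V.

(** The regularity that lets second derivatives be split; it is established together with the
    identities below, from the same local expansions. *)
Definition along_C2 V := [/\ smooth_along_at h V p,
  smooth_along_at h (fun q => P q (X q) V) p &
  smooth_along_at h (fun q => P q (Y q) V) p].

Lemma along_curvature_near V W : (\forall q \near p, V q = W q) -> along_C2 V ->
  along_curvature W = along_curvature V.
Proof.
move=> VW [sV sVX sVY]; rewrite /along_curvature (along_near D _ VW sV).
have eX : \forall q \near p, P q (X q) V = P q (X q) W.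
  by apply: filterS (near_along_near X VW sV).
have eY : \forall q \near p, P q (Y q) V = P q (Y q) W.
  by apply: filterS (near_along_near Y VW sV).
by rewrite (along_near D _ eX sVX) (along_near D _ eY sVY).
Qed.

Lemma along_curvatureD V W : along_C2 V -> along_C2 W ->
  along_C2 (fun q => V q + W q) /\
  along_curvature (fun q => V q + W q) = along_curvature V + along_curvature W.
Proof.
move=> [sV sVX sVY] [sW sWX sWY].
have e Z : \forall q \near p, P q (Z q) V + P q (Z q) W = P q (Z q) (fun q => V q + W q).
  by apply: filterS (near_alongD Z sV sW).
have sDX := smooth_alongD sVX sWX; have sDY := smooth_alongD sVY sWY.
split.
  split; first exact: smooth_alongD.
    exact: smooth_along_eq (e X) sDX.
  exact: smooth_along_eq (e Y) sDY.
rewrite /along_curvature (along_near D _ (e X) sDX) (along_near D _ (e Y) sDY).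
rewrite (alongD D _ sVX sWX) (alongD D _ sVY sWY) (alongD D _ sV sW).
by rewrite !opprD [X in X + _ = _]addrACA [LHS]addrACA.
Qed.

Lemma along_curvature_scale (f : M -> R) V : smooth_at (f : M -> R^o) p -> along_C2 V ->
  along_C2 (fun q => f q *: V q) /\
  along_curvature (fun q => f q *: V q) = f p *: along_curvature V.
Proof.
move=> sf [sV sVX sVY].
have e Z : \forall q \near p, dir_der f q (Z q) *: V q + f q *: P q (Z q) V =
    P q (Z q) (fun q => f q *: V q).
  by apply: filterS (near_along_scale Z sf sV).
have sfX := smooth_dir_der sf sX; have sfY := smooth_dir_der sf sY.
have s1X := smooth_along_scale sfX sV; have s2X := smooth_along_scale sf sVX.
have s1Y := smooth_along_scale sfY sV; have s2Y := smooth_along_scale sf sVY.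
have sDX := smooth_alongD s1X s2X; have sDY := smooth_alongD s1Y s2Y.
split.
  split; first exact: smooth_along_scale.
    exact: smooth_along_eq (e X) sDX.
  exact: smooth_along_eq (e Y) sDY.
rewrite /along_curvature (along_near D _ (e X) sDX) (along_near D _ (e Y) sDY).
rewrite (alongD D _ s1X s2X) (alongD D _ s1Y s2Y).
rewrite (along_scale D _ sfX sV) (along_scale D _ sfY sV).
rewrite (along_scale D _ sf sVX) (along_scale D _ sf sVY) (along_scale D _ sf sV).
rewrite -(dir_der_bracket sf sX sY).
exact: leibniz_commutator.
Qed.

(** Second derivatives along [h] are ambient ones with directions frozen at [h p], plus first
    derivatives caused by the variation of the pushed-forward directions. Antisymmetrised, this
    excess cancels the bracket term. *)
Lemma along_curvature_frame (v : 'rV[R]_n.+1) : along_C2 (fun q => coord_field (h p) v (h q)) /\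
  along_curvature (fun q => coord_field (h p) v (h q)) =
  curvature_tensor D (h p) (dmap h p (X p)) (dmap h p (Y p)) v.
Proof.
have hp := chart_dom_center (h p).
split.
  by split; [exact: smooth_frame_along|exact: smooth_along_coord|
             exact: smooth_along_coord].
(* The first summand differentiates the components of the pushforward of [Z]; the second replaces
   that pushforward by the coordinate field with its value at [p]. *)
have step Z w : smooth_field_at Z p ->
    P p w (fun q => P q (Z q) (fun q => coord_field (h p) v (h q))) =
    D (h p) (\sum_(j < n.+1) dir_der (fun q => components h (pushforward h Z) (h p) q 0 j) p w
       *: delta_mx 0 j) (coord_field (h p) v) +
    D (h p) (dmap h p w) (fun r => D r (coord_field (h p) (dmap h p (Z p)) r)
       (coord_field (h p) v)).
  move=> sZ.
  have sj j : smooth_at (fun q => components h (pushforward h Z) (h p) q 0 j : R^o) p.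
    exact: smooth_component (pushforward_smooth sh sZ).
  have sD j := smooth_along_field sh (smooth_connection_frame p v j).
  have st j := smooth_along_scale (sj j) (sD j).
  have e : \forall q \near p, \sum_(j < n.+1) components h (pushforward h Z) (h p) q 0 j *:
      D (h q) (E (h p) j (h q)) (coord_field (h p) v) =
      P q (Z q) (fun q => coord_field (h p) v (h q)).
    by apply: filterS (near_along_comp p v Z).
  rewrite (along_near D _ e (smooth_along_sum _ st)) along_sum//.
  rewrite (eq_bigr _ (fun j _ => along_scale D w (sj j) (sD j))) big_split /=.
  apply: (congr2 +%R).
    rewrite connection_dir_sum; last exact: coord_field_center_smooth.
    by apply: eq_bigr => j _; rewrite coord_field_center.
  rewrite (eq_bigr _ (fun j _ => congr1 ( *:%R _)
    (along_comp D sh w (smooth_connection_frame p v j)))).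
  have e' : \forall r \near h p, \sum_(j < n.+1) (dmap h p (Z p)) 0 j *:
      D r (E (h p) j r) (coord_field (h p) v) =
      D r (coord_field (h p) (dmap h p (Z p)) r) (coord_field (h p) v).
    apply: filterS (near_chart_dom hp) => r cr.
    by rewrite -connection_dir_sum -?coord_change_sum//; exact: coord_field_smooth.
  have sc j : smooth_field_at (fun r => (dmap h p (Z p)) 0 j *:
      D r (E (h p) j r) (coord_field (h p) v)) (h p).
    by apply: smooth_along_scale (smooth_connection_frame p v j); exact: smooth_at_cst.
  rewrite (connection_near D _ e' (smooth_along_sum _ sc)) connection_sum//.
  apply: eq_bigr => j _; rewrite connection_cst; last exact: smooth_connection_frame.
  by rewrite components_center.
rewrite /along_curvature !step// along_comp//; last exact: coord_field_center_smooth.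
rewrite /curvature_tensor /curvature lie_bracket_coord_field !coord_field_center.
rewrite connection_dir0 ?subr0; last exact: coord_field_center_smooth.
have -> : dmap h p (lie_bracket X Y p) =
  \sum_(j < n.+1) dir_der (fun q => components h (pushforward h Y) (h p) q 0 j) p (X p)
    *: delta_mx 0 j + -1 *:
  \sum_(j < n.+1) dir_der (fun q => components h (pushforward h X) (h p) q 0 j) p (Y p)
    *: delta_mx 0 j.
  rewrite [LHS]row_sum_delta scaler_sumr -big_split; apply: eq_bigr => j _ /=.
  by rewrite -(pushforward_bracket sh j sX sY) scalerBl scaleN1r.
rewrite connection_dirD ?connection_dirZ; try exact: coord_field_center_smooth.
move: (D _ _ _) (D _ _ _) (D _ _ _) (D _ _ _) => a b c d.
by rewrite scaleN1r; apply/rowP => i; rewrite !mxE; ring.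
Qed.

Lemma along_curvatureE V : smooth_along_at h V p -> along_curvature V =
  curvature_tensor D (h p) (dmap h p (X p)) (dmap h p (Y p)) (V p).
Proof.
move=> sV.
pose T k q := components h V (h p) q 0 k *: E (h p) k (h q).
have sT k : along_C2 (T k) /\ along_curvature (T k) = components h V (h p) p 0 k *:
    curvature_tensor D (h p) (dmap h p (X p)) (dmap h p (Y p)) (delta_mx 0 k).
  have [c1 c2] := along_curvature_frame (delta_mx 0 k).
  have [d1 d2] := along_curvature_scale (smooth_component k sV) c1.
  by split=> //; rewrite /T d2 c2.
(* Base case of the sum over the frame, obtained by scaling a frame field by 0. *)
have Z2 : along_C2 (fun=> 0) /\ along_curvature (fun=> 0) = 0.
  have [c1 c2] := along_curvature_frame 0.
  have [] := along_curvature_scale (smooth_at_cst 0 p) c1.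
  rewrite (_ : (fun q => _) = fun=> 0); last by apply/funext => q; rewrite scale0r.
  by rewrite scale0r.
have sum_T (r : seq 'I_n.+1) : along_C2 (fun q => \sum_(k <- r) T k q) /\
    along_curvature (fun q => \sum_(k <- r) T k q) = \sum_(k <- r) along_curvature (T k).
  elim: r => [|k r [IH1 IH2]].
    rewrite (_ : (fun q => _) = fun=> 0) ?big_nil//.
    by apply/funext => q; rewrite big_nil.
  rewrite (_ : (fun q => _) = fun q => T k q + \sum_(k <- r) T k q); last first.
    by apply/funext => q; rewrite big_cons.
  by rewrite big_cons -IH2; apply: along_curvatureD => //; have [] := sT k.
have [s1 s2] := sum_T (index_enum 'I_n.+1).
rewrite (along_curvature_near (near_frame V p) s1) s2 [RHS]curvature_tensor_sum.
by apply: eq_bigr => k _; rewrite (sT k).2 components_center.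
Qed.

End Curvature.

End AlongTheory.

(** * The equations of a hypersurface *)

Section MetricAlong.
Context {R : realType} {n : nat} {M : manifold R n} {M' : manifold R n.+1}.
Variables (h : M -> M') (g : metric M').
Hypothesis sh : smooth_map h.
Implicit Types (D Ds : connection M') (p q : M) (V W : M -> 'rV[R]_n.+1).

(* The smoothness conjunct is kept in the definition because [dir_der] is
   meaningless without it. *)
Definition metric_compatible D Ds p V W :=
  smooth_at (fun q => g (h q) (V q) (W q) : R^o) p /\
  forall u, dir_der (fun q => g (h q) (V q) (W q)) p u =
    g (h p) (derivative_along h D p u V) (W p) +
    g (h p) (V p) (derivative_along h Ds p u W).

Lemma metric_compatible_sym D Ds p V W :
  metric_compatible D Ds p V W -> metric_compatible Ds D p W V.
Proof.
have e : (fun q => g (h q) (W q) (V q)) = (fun q => g (h q) (V q) (W q)).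
  by apply/funext => q; rewrite Defs.metric_sym.
rewrite /metric_compatible e => -[sm de]; split=> // u; rewrite de addrC.
by rewrite Defs.metric_sym; congr (_ + _); rewrite Defs.metric_sym.
Qed.

Lemma dir_der_sum I (r : seq I) (f : I -> M -> R) p u :
  (forall i, smooth_at (f i : M -> R^o) p) ->
  dir_der (fun q => \sum_(i <- r) f i q) p u = \sum_(i <- r) dir_der (f i) p u.
Proof.
move=> sf; have [_ d] := diff_fsum r (fun i => smooth_near_diff (sf i)).
exact: d.
Qed.

(* Expanding one argument in a coordinate frame reduces compatibility to frame
   fields in that argument; by symmetry of duality the same applies to the
   other one. *)
Lemma metric_compatible_frame D Ds p V W : smooth_along_at h V p ->
  (forall v, metric_compatible D Ds p (fun q => coord_field (h p) v (h q)) W) ->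
  metric_compatible D Ds p V W.
Proof.
move=> sV cW; pose E k := coord_field (h p) (delta_mx 0 k : 'rV[R]_n.+1).
pose v k q : R := components h V (h p) q 0 k.
have sv k : smooth_at (v k : M -> R^o) p by exact: smooth_component.
have sE k : smooth_along_at h (fun q => E k (h q)) p.
  by apply: smooth_frame_along => //; exact: chart_dom_center.
have sT k := smooth_along_scale (sv k) (sE k).
have nV := near_frame sh V p.
have sg k : smooth_at (fun q => v k q * g (h q) (E k (h q)) (W q) : R^o) p.
  by apply: smooth_at_scale => //; have [] := cW (delta_mx 0 k).
have e : \forall q \near p, \sum_(k < n.+1) v k q * g (h q) (E k (h q)) (W q) =
    g (h q) (V q) (W q).
  apply: filterS nV => q <-; rewrite metric_suml.
  by apply: eq_bigr => k _; rewrite metricZl.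
have ss := smooth_at_sum (index_enum 'I_n.+1) sg.
split; first exact: smooth_at_eq e ss.
move=> u; rewrite (near_eq_dir_der u e ss) dir_der_sum//.
rewrite (along_near D u nV (smooth_along_sum _ sT)) along_sum//.
rewrite -[in X in _ = _ + X](nbhs_singleton nV) !metric_suml -big_split /=.
apply: eq_bigr => k _; have [c1 c2] := cW (delta_mx 0 k).
rewrite (dir_derM u (sv k) c1) c2 (along_scale D u (sv k) (sE k)).
rewrite (metricDl g (h p) (dir_der (v k) p u *: E k (h p))) !metricZl /v /E /=; ring.
Qed.

(** Expanding each argument, with the connections swapped in between, leaves two restricted
    coordinate fields, for which this is the ambient duality at [h p]. *)
Lemma along_metric D Ds p V W : dual_connection g D Ds ->
  smooth_along_at h V p -> smooth_along_at h W p -> metric_compatible D Ds p V W.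
Proof.
move=> dual sV sW; apply: metric_compatible_frame => // v.
apply: metric_compatible_sym; apply: metric_compatible_frame => // w.
apply: metric_compatible_sym.
have s u := coord_field_center_smooth (h p) u.
have sG := Defs.metric_smooth g (s v) (s w).
split; first exact: (smooth_at_comp sh sG).
move=> u; rewrite (dir_der_map sh u sG) !along_comp//.
have := dual (h p) _ _ _ (s v) (s w) (s (dmap h p u)).
by rewrite (coord_field_center (h p) (dmap h p u)) addrC.
Qed.

End MetricAlong.

(** * Gauss and Weingarten formulas and their consequences *)

Section GaussWeingarten.
Context {R : realType} {n : nat} {M : manifold R n} {M' : manifold R n.+1}.
Variables (g' : metric M') (iota : M -> M') (N : M -> 'rV[R]_n.+1).
Hypotheses (himm : immersion iota) (hN : unit_normal iota g' N).
Implicit Types (A B : tensor11 M).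
Implicit Types (X Y Z : M -> 'rV[R]_n) (p q : M) (u v w : 'rV[R]_n).

Local Notation G := (induced_metric iota g').
Local Notation d := (dmap iota).
Let si : smooth_map iota := himm.1.

Lemma dmapD p u v : d p (u + v) = d p u + d p v. Proof. exact: raddfD. Qed.
Lemma dmapB p u v : d p (u - v) = d p u - d p v. Proof. exact: raddfB. Qed.
Lemma dmapZ p a u : d p (a *: u) = a *: d p u. Proof. exact: linearZ. Qed.

Lemma induced_metric_sym p u v : G p u v = G p v u.
Proof. exact: Defs.metric_sym. Qed.

Lemma induced_metricDl p u v w : G p (u + v) w = G p u w + G p v w.
Proof. by rewrite /induced_metric dmapD metricDl. Qed.

Lemma induced_metricBl p u v w : G p (u - v) w = G p u w - G p v w.
Proof. by rewrite /induced_metric dmapB metricBl. Qed.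

Lemma induced_metricZl p a u w : G p (a *: u) w = a * G p u w.
Proof. by rewrite /induced_metric dmapZ metricZl. Qed.

Lemma normal_tangent p u : g' (iota p) (N p) (d p u) = 0.
Proof. by have [_ _ ->] := hN. Qed.

Lemma tangent_normal p u : g' (iota p) (d p u) (N p) = 0.
Proof. by rewrite Defs.metric_sym normal_tangent. Qed.

(** Pairing with [N] isolates [a]; injectivity of the differential then gives [u]. *)
Lemma tangent_normal_eq0 p u (a : R) : d p u + a *: N p = 0 -> u = 0 /\ a = 0.
Proof.
move=> e; have a0 : a = 0.
  have [_ NN _] := hN; have := metric0l g' (iota p) (N p).
  by rewrite -e metricDl tangent_normal metricZl NN mulr1 add0r.
split=> //; apply: (himm.2 p); move: e; rewrite a0 scale0r addr0 => ->.
by rewrite -(subrr u) dmapB subrr.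
Qed.

Lemma gauss_at (D' : connection M') (D : connection M) B p u Y :
  gauss_formula iota g' N D' D B -> smooth_field_at Y p ->
  derivative_along iota D' p u (pushforward iota Y) =
  d p (D p u Y) + G p (B p u) (Y p) *: N p.
Proof.
move=> gauss sY; have := gauss p _ _ (coord_field_center_smooth p u) sY.
by rewrite coord_field_center.
Qed.

(** Subtract the two Gauss formulas and insert [along_torsion]: the tangential part says that [D] is
    torsion-free, the normal part that [B] is self-adjoint. *)
Lemma gauss_torsion (D' : connection M') (D : connection M) B p X Y :
  torsion_free D' -> gauss_formula iota g' N D' D B ->
  smooth_field_at X p -> smooth_field_at Y p ->
  D p (X p) Y - D p (Y p) X = lie_bracket X Y p /\
  G p (B p (X p)) (Y p) = G p (B p (Y p)) (X p).
Proof.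
move=> tD' gauss sX sY; have := along_torsion si tD' sX sY.
rewrite (gauss p X Y sX sY) (gauss p Y X sY sX) => e.
have [] := @tangent_normal_eq0 p (D p (X p) Y - D p (Y p) X - lie_bracket X Y p)
    (G p (B p (X p)) (Y p) - G p (B p (Y p)) (X p)).
  rewrite (dmapB p (D p (X p) Y - _)) (dmapB p (D p (X p) Y)) -e scalerBl.
  move: (d p _) (d p _) (N p) (G p _ _) (G p _ _) => a b nn x y.
  by apply/rowP => i; rewrite !mxE; ring.
by move=> /eqP; rewrite subr_eq0 => /eqP -> /eqP; rewrite subr_eq0 => /eqP ->.
Qed.

Lemma shape_sym (D' : connection M') (D : connection M) B p u v :
  torsion_free D' -> gauss_formula iota g' N D' D B ->
  G p (B p u) v = G p (B p v) u.
Proof.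
move=> tD' gauss.
have [_] := gauss_torsion tD' gauss (coord_field_center_smooth p u)
  (coord_field_center_smooth p v).
by rewrite !coord_field_center.
Qed.

(** [Ds] falls on the first argument because [curvature_tangent] uses this with [As] applied to a
    field there, and its derivative has to produce [nabla_bar_star]. *)
Lemma induced_metric_der (D' Ds' : connection M') (D Ds : connection M) A B
    p u Y Z : dual_connection g' D' Ds' ->
  gauss_formula iota g' N D' D B -> gauss_formula iota g' N Ds' Ds A ->
  smooth_field_at Y p -> smooth_field_at Z p ->
  smooth_at (fun q => G q (Y q) (Z q) : R^o) p /\
  dir_der (fun q => G q (Y q) (Z q)) p u = G p (Ds p u Y) (Z p) + G p (D p u Z) (Y p).
Proof.
move=> dual gauss gausss sY sZ.
have [s1 s2] := along_metric si (dual_connection_sym dual)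
  (pushforward_smooth si sY) (pushforward_smooth si sZ).
split=> //; rewrite [LHS]s2 (gauss_at _ gauss sZ) (gauss_at _ gausss sY).
rewrite metricDl metricZl normal_tangent mulr0 addr0; congr (_ + _).
by rewrite Defs.metric_sym metricDl metricZl normal_tangent mulr0 addr0.
Qed.

Section CurvatureEquations.
Variables (D' Ds' : connection M') (D Ds : connection M) (A As : tensor11 M).
Variable kappa : one_form M.
Hypotheses (dual : dual_connection g' D' Ds').
Hypotheses (tD' : torsion_free D') (tDs' : torsion_free Ds').
Hypotheses (gauss : gauss_formula iota g' N D' D As).
Hypothesis weingarten : weingarten_formula iota N D' A (fun p u => kappa p u).
Hypothesis gauss_dual : gauss_formula iota g' N Ds' Ds A.
Variables (X Y : M -> 'rV[R]_n).
Hypotheses (sX : smooth_field X) (sY : smooth_field Y).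

Local Notation P := (derivative_along iota D').

Let sN : smooth_along iota N. Proof. by have [] := hN. Qed.

Lemma curvature_tangent Z p : smooth_field Z ->
  curvature_tensor D' (iota p) (d p (X p)) (d p (Y p)) (d p (Z p)) =
    d p (curvature D X Y Z p)
    - G p (As p (Y p)) (Z p) *: d p (A p (X p))
    + G p (As p (X p)) (Z p) *: d p (A p (Y p))
    + (G p (nabla_bar_star Ds As kappa X Y p) (Z p)
       - G p (nabla_bar_star Ds As kappa Y X p) (Z p)) *: N p.
Proof.
move=> sZ; have spZ := pushforward_smooth si (sZ p).
rewrite -(along_curvatureE D' si (sX p) (sY p) spZ) /along_curvature.
(* Differentiates the Gauss decomposition once more: Gauss on the tangential part; Leibniz, induced
   duality and Weingarten on the normal part. *)
have second U W : smooth_field U -> smooth_field W ->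
    P p (U p) (fun q => P q (W q) (pushforward iota Z)) =
    d p (D p (U p) (fun q => D q (W q) Z)) + G p (As p (U p)) (D p (W p) Z) *: N p +
    ((G p (Ds p (U p) (fun q => As q (W q))) (Z p) + G p (D p (U p) Z) (As p (W p)))
       *: N p +
     G p (As p (W p)) (Z p) *: (- d p (A p (U p)) + kappa p (U p) *: N p)).
  move=> sU sW.
  have -> : (fun q => P q (W q) (pushforward iota Z)) =
      (fun q => pushforward iota (fun q => D q (W q) Z) q +
                G q (As q (W q)) (Z q) *: N q).
    by apply/funext => q; rewrite (gauss_at _ gauss (sZ q)).
  have sDZ : smooth_field_at (fun q => D q (W q) Z) p by exact: connection_smooth.
  have sAW : smooth_field_at (fun q => As q (W q)) p by exact: tensor11_smooth.
  have [sG dG] := induced_metric_der (U p) dual gauss gauss_dual sAW (sZ p).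
  rewrite (alongD D' _ (pushforward_smooth si sDZ) (smooth_along_scale sG (sN p))).
  rewrite (along_scale D' _ sG (sN p)) dG (gauss_at _ gauss sDZ).
  by rewrite weingarten.
rewrite (second X Y)// (second Y X)// (gauss_at _ gauss (sZ p)).
(* The bracket inside [As] is expressed through [Ds], as [nabla_bar_star] requires; the one in
   [D p L Z] stays, being part of [curvature]. *)
have [br _] := gauss_torsion tDs' gauss_dual (sX p) (sY p).
rewrite /curvature; move: (lie_bracket X Y p) br => L br.
have AsL : As p L = As p (Ds p (X p) Y) - As p (Ds p (Y p) X) by rewrite -br raddfB.
rewrite AsL !dmapB /nabla_bar_star.
rewrite !(induced_metricBl, induced_metricDl, induced_metricZl).
(* Aligns the mixed terms pairing [As] with a derivative of [Z], so that they cancel in pairs. *)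
rewrite !(induced_metric_sym p (D p _ Z)).
move: (d p _) (d p _) (d p _) (d p _) (d p _) (N p) => a b c e f nn.
do 12?[move: (G p _ _) => ?]; move: (kappa p _) (kappa p _) => k l.
by apply/rowP => i; rewrite !mxE; ring.
Qed.

Lemma curvature_normal p :
  curvature_tensor D' (iota p) (d p (X p)) (d p (Y p)) (N p) =
    - d p (nabla_bar D A kappa X Y p) + d p (nabla_bar D A kappa Y X p)
    - (G p (tensor_commutator A As p (X p)) (Y p) - d_form D kappa X Y p) *: N p.
Proof.
rewrite -(along_curvatureE D' si (sX p) (sY p) (sN p)) /along_curvature.
have second U W : smooth_field U -> smooth_field W ->
    P p (U p) (fun q => P q (W q) N) =
    - (d p (D p (U p) (fun q => A q (W q))) + G p (As p (U p)) (A p (W p)) *: N p) +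
    (dir_der (fun q => kappa q (W q)) p (U p) *: N p +
     kappa p (W p) *: (- d p (A p (U p)) + kappa p (U p) *: N p)).
  move=> sU sW.
  have -> : (fun q => P q (W q) N) =
      (fun q => -1 *: pushforward iota (fun q => A q (W q)) q + kappa q (W q) *: N q).
    by apply/funext => q; rewrite weingarten scaleN1r.
  have sAW : smooth_field_at (fun q => A q (W q)) p by exact: tensor11_smooth.
  have sk := one_form_smooth kappa (sW p).
  have s1 := smooth_at_cst (-1 : R^o) p.
  rewrite (alongD D' _ (smooth_along_scale s1 (pushforward_smooth si sAW))
    (smooth_along_scale sk (sN p))).
  rewrite (along_scale D' _ s1 (pushforward_smooth si sAW)) dir_der_cst scale0r add0r scaleN1r.
  by rewrite (along_scale D' _ sk (sN p)) (gauss_at _ gauss sAW) weingarten.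
rewrite (second X Y)// (second Y X)// weingarten.
(* Here the bracket is expressed through [D], the connection in [nabla_bar] and [d_form]. *)
have [br _] := gauss_torsion tD' gauss (sX p) (sY p).
move: (lie_bracket X Y p) br => L br.
have AL : A p L = A p (D p (X p) Y) - A p (D p (Y p) X) by rewrite -br raddfB.
have kL : kappa p L = kappa p (D p (X p) Y) - kappa p (D p (Y p) X).
  by rewrite -br raddfB.
rewrite AL kL /nabla_bar /d_form /nabla_form /tensor_commutator.
rewrite !(dmapB, dmapZ) induced_metricBl.
(* Self-adjointness of both shape operators turns the commutator term into the products of [A] and
   [As] left by [second]. *)
rewrite (shape_sym p (As p (X p)) _ tDs' gauss_dual).
rewrite (shape_sym p (A p (X p)) _ tD' gauss).
rewrite (induced_metric_sym p (A p (Y p))).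
do 10?[move: (d p _) => ?]; move: (N p) => nn.
do 5?[move: (G p _ _) => ?]; do 5?[move: (kappa p _) => ?].
do 3?[move: (dir_der _ _ _) => ?].
by apply/rowP => i; rewrite !mxE; ring.
Qed.

End CurvatureEquations.

End GaussWeingarten.

(** * Change of sign of the normal form under duality *)

Section OppositeForm.
Context {R : realType} {n : nat} {M : manifold R n} (kappa : one_form M).

Lemma opp_form_smooth p (X : M -> 'rV[R]_n) : smooth_field_at X p ->
  smooth_at (fun q => (\- kappa q) (X q) : R^o) p.
Proof.
move=> sX; have := smooth_at_scale (smooth_at_cst (-1 : R^o) p) (one_form_smooth kappa sX).
by congr smooth_at; apply/funext => q; rewrite /= scaleN1r.
Qed.

Definition opp_form : one_form M :=
  @OneForm R n M (fun q => \- kappa q) opp_form_smooth.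

Lemma opp_formE p u : opp_form p u = - kappa p u.
Proof. by []. Qed.

Lemma nabla_bar_opp (D : connection M) (A : tensor11 M) X Y p :
  nabla_bar D A opp_form X Y p = nabla_bar_star D A kappa X Y p.
Proof. by rewrite /nabla_bar opp_formE scaleNr opprK. Qed.

Lemma nabla_bar_star_opp (D : connection M) (A : tensor11 M) X Y p :
  nabla_bar_star D A opp_form X Y p = nabla_bar D A kappa X Y p.
Proof. by rewrite /nabla_bar_star opp_formE scaleNr. Qed.

(** [d_form] depends on the connection only through its antisymmetrised derivative of fields, so
    replacing [D] by [Ds] costs nothing and only the sign of [kappa] remains. *)
Lemma d_form_opp (D Ds : connection M) X Y p :
  smooth_field_at X p -> smooth_field_at Y p ->
  D p (X p) Y - D p (Y p) X = Ds p (X p) Y - Ds p (Y p) X ->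
  d_form Ds opp_form X Y p = - d_form D kappa X Y p.
Proof.
move=> sX sY e.
have der u Z : smooth_field_at Z p ->
    dir_der (fun q => opp_form q (Z q)) p u = - dir_der (fun q => kappa q (Z q)) p u.
  move=> sZ; have sk := one_form_smooth kappa sZ.
  rewrite (_ : (fun q => _) = fun q => -1 * kappa q (Z q)); last first.
    by apply/funext => q; rewrite mulN1r.
  by rewrite (dir_derM u (smooth_at_cst (-1 : R^o) p) sk) dir_der_cst mul0r add0r mulN1r.
have algebra (s t a b a' b' : R) : a - b = a' - b' ->
    - s - (- a') - (- t - (- b')) = - (s - a - (t - b)) by lra.
rewrite /d_form /nabla_form !der// !opp_formE; apply: algebra.
by have := congr1 (kappa p) e; rewrite !raddfB.
Qed.

End OppositeForm.

Theorem proposition5p5 (R : realType) (n : nat)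
    (* the ambient locally product-like statistical manifold *)
    (M' : manifold R n.+1) (g' : metric M') (D' Ds' : connection M')
    (F Fs : tensor11 M')
    (hstat : statistical g' D') (hdual : dual_connection g' D' Ds')
    (hF : product_like g' D' F Fs)
    (* the tangential hypersurface *)
    (M : manifold R n) (iota : M -> M') (N : M -> 'rV[R]_n.+1)
    (himm : immersion iota) (hN : unit_normal iota g' N)
    (htan : tangential iota F Fs N)
    (* the induced objects *)
    (D Ds : connection M) (A As : tensor11 M) (kappa : one_form M)
    (hGW : gauss_weingarten iota g' N D' Ds' D Ds A As kappa)
    (X Y Z : M -> 'rV[R]_n)
    (hX : smooth_field X) (hY : smooth_field Y) (hZ : smooth_field Z) (p : M) :
  let g := induced_metric iota g' p in
  let d := dmap iota p in
  let R' := curvature_tensor D' (iota p) in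
  let Rs' := curvature_tensor Ds' (iota p) in
  [/\ R' (d (X p)) (d (Y p)) (d (Z p)) =
        d (curvature D X Y Z p)
        - g (As p (Y p)) (Z p) *: d (A p (X p))
        + g (As p (X p)) (Z p) *: d (A p (Y p))
        + (g (nabla_bar_star Ds As kappa X Y p) (Z p)
           - g (nabla_bar_star Ds As kappa Y X p) (Z p)) *: N p,
      R' (d (X p)) (d (Y p)) (N p) =
        - d (nabla_bar D A kappa X Y p) + d (nabla_bar D A kappa Y X p)
        - (g (tensor_commutator A As p (X p)) (Y p)
           - d_form D kappa X Y p) *: N p,
      Rs' (d (X p)) (d (Y p)) (d (Z p)) =
        d (curvature Ds X Y Z p)
        - g (A p (Y p)) (Z p) *: d (As p (X p))
        + g (A p (X p)) (Z p) *: d (As p (Y p))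
        + (g (nabla_bar D A kappa X Y p) (Z p)
           - g (nabla_bar D A kappa Y X p) (Z p)) *: N p
    & Rs' (d (X p)) (d (Y p)) (N p) =
        - d (nabla_bar_star Ds As kappa X Y p)
        + d (nabla_bar_star Ds As kappa Y X p)
        + (g (tensor_commutator A As p (X p)) (Y p)
           - d_form D kappa X Y p) *: N p].
Proof.
move=> g d R' Rs'.
have [gauss wein gauss_dual wein_dual] := hGW.
have [tD' _] := hstat; have tDs' := dual_torsion_free hdual hstat.
have hsym := dual_connection_sym hdual.
have wein_dual' : weingarten_formula iota N Ds' As (fun p u => opp_form kappa p u).
  exact: wein_dual.
split.
- exact: (curvature_tangent himm hN hdual tDs' gauss wein gauss_dual).
- exact: (curvature_normal himm hN tD' tDs' gauss wein gauss_dual).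
(* Writing [nabla_bar] as the starred operator of [opp_form kappa] gives the goal the shape of the
   first equation for the exchanged data. *)
- rewrite -!(nabla_bar_star_opp kappa D A).
  exact: (curvature_tangent himm hN hsym tD' gauss_dual wein_dual' gauss).
- rewrite -!(nabla_bar_opp kappa Ds As).
  rewrite [LHS](curvature_normal himm hN tDs' tD' gauss_dual wein_dual' gauss hX hY).
  have [br _] := gauss_torsion himm hN tD' gauss (hX p) (hY p).
  have [brs _] := gauss_torsion himm hN tDs' gauss_dual (hX p) (hY p).
  rewrite (d_form_opp kappa (hX p) (hY p) (etrans br (esym brs))).
  (* The exchange reverses both the commutator and [d_form], which gives the opposite sign of the
     normal part. *)
  have -> : tensor_commutator As A p (X p) = -1 *: tensor_commutator A As p (X p).
    by rewrite scaleN1r /tensor_commutator opprB.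
  rewrite induced_metricZl /g.
  congr (_ + _); rewrite -scaleNr; congr (_ *: _); ring.
Qed.
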